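(* Let $(\Sigma,\alpha)$ be an $R$-Cartan structure and $(\Sigma,\omega)$ an $(I,J,K)$-generalized Finsler structure on the same 3-manifold $\Sigma$. Let $A=(a_{ij}):T^*\Sigma\to T^*\Sigma$, $\omega=A\alpha$, be a linear transformation whose matrix elements $a_{ij}$ are solutions of the first-order system (S) described in the context, and let $(\mathcal I,\mathcal J)$, $\mathcal I=\{\theta_{ij}\}$, $\mathcal J=\{\theta_{ij},\alpha^k\}$, be the corresponding linear Pfaffian system on the 30-dimensional manifold $\widetilde\Sigma$ (with independence condition $\alpha^1\wedge\alpha^2\wedge\alpha^3\neq0$), as described in the context. Then $(\mathcal I,\mathcal J)$ has non-absorbable torsion, namely the torsion terms $T_{13}\,\alpha^1\wedge\alpha^2$, $T_{23}\,\alpha^1\wedge\alpha^2$, $T_{33}\,\alpha^1\wedge\alpha^2$ in $d\theta_{13}$, $d\theta_{23}$, $d\theta_{33}$, respectively, where $$\begin{aligned} T_{13}=&-(A_{13\cdot3}+A_{11\cdot1}-A_{12\cdot2})+I(A_{23\cdot3}+A_{21\cdot1}-A_{22\cdot2})+(I_1A_{21}-I_2A_{22}+I_3A_{23}),\\ T_{23}=&\;A_{23\cdot3}+A_{21\cdot1}-A_{22\cdot2},\\ T_{33}=&-K(A_{33\cdot3}+A_{31\cdot1}-A_{32\cdot2})+J(A_{23\cdot3}+A_{21\cdot1}-A_{22\cdot2})\\ &-(K_1A_{31}-K_2A_{32}+K_3A_{33})+(J_1A_{21}-J_2A_{22}+J_3A_{23}). \end{aligned}$$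
   Context: **Structures.** An $R$-Cartan structure on a 3-manifold $\Sigma$ ($R$ a smooth function on $\Sigma$) is a coframing $\alpha=(\alpha^1,\alpha^2,\alpha^3)$ with $d\alpha^1=\alpha^2\wedge\alpha^3$, $d\alpha^2=-\alpha^1\wedge\alpha^3$, $d\alpha^3=R\,\alpha^1\wedge\alpha^2$. An $(I,J,K)$-generalized Finsler structure ($I,J,K$ smooth functions on $\Sigma$) is a coframing $\omega=(\omega^1,\omega^2,\omega^3)$ with $d\omega^1=-I\omega^1\wedge\omega^3+\omega^2\wedge\omega^3$, $d\omega^2=-\omega^1\wedge\omega^3$, $d\omega^3=K\omega^1\wedge\omega^2-J\omega^1\wedge\omega^3$. **Notation.** For a function $f$ on $\Sigma$, $df=f_1\alpha^1+f_2\alpha^2+f_3\alpha^3$. For the matrix entries, $da_{ij}=a_{ij\cdot1}\alpha^1+a_{ij\cdot2}\alpha^2+a_{ij\cdot3}\alpha^3$. $A_{ij}$ is the (unsigned) minor of the entry $a_{ij}$ in $A$, e.g. $A_{11}=a_{22}a_{33}-a_{23}a_{32}$, $A_{12}=a_{21}a_{33}-a_{23}a_{31}$. $\omega=A\alpha$ means $\omega^i=\sum_j a_{ij}\alpha^j$. Put $B_{112}=a_{13}R+IA_{23}-A_{13}$, $B_{212}=a_{23}R+A_{23}$, $B_{312}=a_{33}R-KA_{33}+JA_{23}$, $B_{123}=a_{11}+IA_{21}-A_{11}$, $B_{223}=a_{21}+A_{21}$, $B_{323}=a_{31}-KA_{31}+JA_{21}$, $B_{131}=a_{12}-IA_{22}+A_{12}$,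 $B_{231}=a_{22}-A_{22}$, $B_{331}=a_{32}+KA_{32}-JA_{22}$. **System (S)** (obtained by taking the exterior derivative of $\omega=A\alpha$ and using both sets of structure equations): for $i=1,2,3$, $$a_{i1\cdot2}=a_{i2\cdot1}+B_{i12},\qquad a_{i3\cdot1}=a_{i1\cdot3}+B_{i31},\qquad a_{i2\cdot3}=a_{i3\cdot2}+B_{i23}.$$ **Pfaffian system.** In the jet space $J^1(3,9)=\Sigma\times\mathbb R^9\times\mathbb R^{27}$ with coordinates (local coordinates of $\Sigma$; $a_{ij}$; $a_{ij\cdot k}$), let $\widetilde\Sigma$ be the 30-dimensional submanifold defined by the nine equations (S); fibre coordinates on it are all $a_{ij}$ and all $a_{ij\cdot k}$ except $a_{i1\cdot2},a_{i3\cdot1},a_{i2\cdot3}$. On $\widetilde\Sigma$ set, for $i=1,2,3$, $$\begin{aligned}\theta_{i1}&=da_{i1}-a_{i1\cdot1}\alpha^1-(a_{i2\cdot1}+B_{i12})\alpha^2-a_{i1\cdot3}\alpha^3,\\ \theta_{i2}&=da_{i2}-a_{i2\cdot1}\alpha^1-a_{i2\cdot2}\alpha^2-(a_{i3\cdot2}+B_{i23})\alpha^3,\\ \theta_{i3}&=da_{i3}-(a_{i1\cdot3}+B_{i31})\alpha^1-a_{i3\cdot2}\alpha^2-a_{i3\cdot3}\alpha^3.\end{aligned}$$ For a function $G$ of the point of $\Sigma$ and the $a_{ij}$ (such as a minor $A_{ij}$), $G_{\cdot k}$ denotes the formal derivative determined by $dG\equiv G_{\cdot1}\alpha^1+G_{\cdot2}\alpha^2+G_{\cdot3}\alpha^3$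 modulo the $\theta_{ij}$. **Torsion.** Modulo the $\theta$'s, the structure equations take, for suitable one-forms $\Pi_{ijk}$ (18 of them, independent modulo the $\theta$'s and $\alpha$'s), the form $d\theta_{i1}=\Pi_{i11}\wedge\alpha^1+\Pi_{i21}\wedge\alpha^2+\Pi_{i13}\wedge\alpha^3$, $d\theta_{i2}=\Pi_{i21}\wedge\alpha^1+\Pi_{i22}\wedge\alpha^2+\Pi_{i32}\wedge\alpha^3$, $d\theta_{i3}=\Pi_{i13}\wedge\alpha^1+\Pi_{i32}\wedge\alpha^2+\Pi_{i33}\wedge\alpha^3+T_{i3}\,\alpha^1\wedge\alpha^2$. ''Non-absorbable'' is meant in the usual Cartan–Kähler sense: the torsion terms $T_{i3}\,\alpha^1\wedge\alpha^2$ cannot be removed by modifying the forms $\Pi_{ijk}$ by combinations of $\alpha^1,\alpha^2,\alpha^3$, except where $T_{i3}=0$ (so $T_{13}=T_{23}=T_{33}=0$ are the torsion conditions of the system). *)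

(* Defs.v *)
From mathcomp Require Import all_boot all_order all_algebra.
From mathcomp Require Import all_classical all_reals all_analysis.

Set Implicit Arguments.
Unset Strict Implicit.
Unset Printing Implicit Defensive.

Import Order.TTheory GRing.Theory Num.Theory numFieldNormedType.Exports.
Local Open Scope classical_set_scope.
Local Open Scope ring_scope.

Section Euclidean.
Variables (F : realType) (n : nat).

Definition pd (l : 'I_n) (f : 'rV[F]_n -> F) (x : 'rV[F]_n) : F :=
  'D_(delta_mx 0 l) f x.

Fixpoint Ck (k : nat) (U : set 'rV[F]_n) (f : 'rV[F]_n -> F) : Prop :=
  if k is k'.+1 then
    (forall x, U x -> differentiable f x) /\ (forall l, Ck k' U (pd l f))
  else forall x, U x -> {for x, continuous f}.

(* To be used with [U] open. *)
Definition smooth_on (U : set 'rV[F]_n) (f : 'rV[F]_n -> F) : Prop :=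
  forall k, Ck k U f.

End Euclidean.

(* [chart c] and [chart_inv c] are total functions, meaningful only on
   [chart_dom c] and on [chart_img], respectively. *)
Record smooth_atlas (F : realType) (n : nat) (M : topologicalType) :=
  SmoothAtlas {
  chart_index : Type;
  chart_dom : chart_index -> set M;
  chart : chart_index -> M -> 'rV[F]_n;
  chart_inv : chart_index -> 'rV[F]_n -> M;
  chart_cover : forall p : M, exists c, chart_dom c p;
  chart_dom_open : forall c, open (chart_dom c);
  chart_img_open : forall c, open (chart c @` chart_dom c);
  chartK : forall c p, chart_dom c p -> chart_inv c (chart c p) = p;
  chart_continuous : forall c p,
    chart_dom c p -> {for p, continuous (chart c)};
  chart_inv_continuous : forall c p,
    chart_dom c p -> {for chart c p, continuous (chart_inv c)};
  chart_transition_smooth : forall c c' (j : 'I_n),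
    smooth_on (chart c @` (chart_dom c `&` chart_dom c'))
              (fun x => chart c' (chart_inv c x) 0 j) }.

Record manifold (F : realType) (n : nat) := Manifold {
  msort :> topologicalType;
  matlas : smooth_atlas F n msort;
  manifold_hausdorff : hausdorff_space msort;
  manifold_second_countable : @second_countable msort }.

(* A form is given by its local expressions: a covector (resp. an alternating
    matrix) of components with respect to [dx_1, ..., dx_n], for each chart [c]
    and each point of [chart_dom c]; the values elsewhere are irrelevant. *)

Section Forms.
Variables (F : realType) (n : nat) (M : topologicalType).
Variable A : smooth_atlas F n M.
Implicit Types (c : chart_index A) (f : M -> F).

Definition chart_img c : set 'rV[F]_n := @chart _ _ _ A c @` @chart_dom _ _ _ A c.

Definition smooth_fun f : Prop :=
  forall c, smooth_on (chart_img c) (f \o chart_inv c).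

Definition local1 := chart_index A -> M -> 'rV[F]_n.
Definition local2 := chart_index A -> M -> 'M[F]_n.

(* Jacobian matrix at [p] of the coordinates of [c'] in terms of those of [c]. *)
Definition jac c c' (p : M) : 'M[F]_n :=
  \matrix_(k, l) pd l (fun x => chart c' (chart_inv c x) 0 k) (chart c p).

Definition one_form (eta : local1) : Prop :=
  (forall c j, smooth_on (chart_img c) (fun x => eta c (chart_inv c x) 0 j)) /\
  (forall c c' p, chart_dom c p -> chart_dom c' p ->
     eta c p = eta c' p *m jac c c' p).

Definition dfun f : local1 :=
  fun c p => \row_l pd l (f \o chart_inv c) (chart c p).

Definition dform (eta : local1) : local2 :=
  fun c p => \matrix_(k, l)
    (pd k (fun x => eta c (chart_inv c x) 0 l) (chart c p)
     - pd l (fun x => eta c (chart_inv c x) 0 k) (chart c p)).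

Definition coframing (alpha : 'I_n -> local1) : Prop :=
  (forall i, one_form (alpha i)) /\
  (forall c p, chart_dom c p -> row_free (\matrix_(i < n) alpha i c p)).

(* The row of the [f_k] in [df = \sum_k f_k alpha^k]; for a coframing it exists
   and is unique, so that the default value [0] is not used. *)
Definition frame_deriv (alpha : 'I_n -> local1) f (p : M) : 'rV[F]_n :=
  xget 0 [set v : 'rV[F]_n | forall c, chart_dom c p ->
    dfun f c p = \sum_k v 0 k *: alpha k c p].

End Forms.

Definition wedge (F : realType) (n : nat) (u v : 'rV[F]_n) : 'M[F]_n :=
  \matrix_(k, l) (u 0 k * v 0 l - u 0 l * v 0 k).

Section SmoothLemmas.
Variables (F : realType) (n : nat).

Lemma Ck_sub k (U V : set 'rV[F]_n) f : V `<=` U -> Ck k U f -> Ck k V f.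
Proof.
move=> VU; elim: k f => [|k IH] f /=; first by move=> cf x /VU; exact: cf.
by move=> [df pf]; split=> [x /VU|l]; [exact: df|exact: IH].
Qed.

Lemma Ck_cst k (U : set 'rV[F]_n) (a : F) : Ck k U (fun=> a).
Proof.
elim: k a => [|k IH] a /=; first by move=> x _; exact: cst_continuous.
split=> [x _|l]; first exact: differentiable_cst.
suff -> : pd l (fun=> a) = fun=> 0 by exact: IH.
by apply/funext => x; rewrite /pd; exact: derive_cst.
Qed.

Lemma Ck_coord k (U : set 'rV[F]_n) j : Ck k U (fun x : 'rV[F]_n => x 0 j).
Proof.
have dc x : differentiable (fun x : 'rV[F]_n => x 0 j) x.
  exact: differentiable_coord.
case: k => [|k] /=; first by move=> x _; exact: coord_continuous.
split=> [x _|l]; first exact: dc.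
suff -> : pd l (fun x => x 0 j) = fun=> (delta_mx 0 l : 'rV[F]_n) 0 j.
  exact: Ck_cst.
apply/funext => x; rewrite /pd /derive; apply: cvg_lim => //.
apply: cvg_near_cst; near=> h; rewrite /= !mxE addrK scalerA mulVf ?scale1r//.
by near: h; exact: nbhs_dnbhs_neq.
Unshelve. all: by end_near. Qed.

Lemma continuous_rowP (T : topologicalType) (f : T -> 'rV[F]_n) (p : T) :
  (forall j, {for p, continuous (fun q => f q 0 j)}) ->
  {for p, continuous f}.
Proof.
move=> cf; apply/cvg_ballP => e e0.
have : \forall q \near p, forall j, ball (f p 0 j) e (f q 0 j).
  by apply: filter_forall => j; apply: (cf j); exact: nbhsx_ballx.
by apply: filterS => q pq; split=> // i j; rewrite (ord1 i); exact: pq.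
Qed.

End SmoothLemmas.

Section ProductLemmas.
Variables (F : realType) (n m : nat).

Lemma pd_lsubmx (f : 'rV[F]_n -> F) (l : 'I_(n + m)) :
  pd l (f \o lsubmx) =
  match fintype.split l with inl j => pd j f \o lsubmx | inr _ => fun=> 0 end.
Proof.
apply/funext => x; rewrite /pd /derive /=.
case: fintype.splitP => j lj /=; last first.
  apply: cvg_lim => //; apply: cvg_near_cst; apply: nearW => h /=.
  suff -> : lsubmx (h *: delta_mx 0 l + x) = lsubmx x by rewrite subrr scaler0.
  apply/rowP => i; rewrite !mxE eqxx /= -val_eqE /= lj.
  by rewrite ltn_eqF ?mulr0 ?add0r// (leq_trans (ltn_ord i))// leq_addr.
apply: (congr1 (fun g : F -> F => lim (g @ 0^'))); apply/funext => h /=.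
suff -> : lsubmx (h *: delta_mx 0 l + x) = h *: delta_mx 0 j + lsubmx x by [].
by apply/rowP => i; rewrite !mxE eqxx /= -!val_eqE /= lj.
Qed.

Lemma Ck_lsubmx k (U : set 'rV[F]_n) (f : 'rV[F]_n -> F) :
  Ck k U f -> Ck k [set x : 'rV[F]_(n + m) | U (lsubmx x)] (f \o lsubmx).
Proof.
elim: k f => [|k IH] f /=.
  move=> cf x Ux; apply: continuous_comp; first exact: continuous_lsubmx.
  exact: cf.
move=> [df pf]; split=> [x Ux|l].
  by apply: differentiable_comp; [exact: differentiable_lsubmx|exact: df].
by rewrite pd_lsubmx; case: fintype.split => j; [exact: IH|exact: Ck_cst].
Qed.

End ProductLemmas.

Section Product.
Variables (F : realType) (n m : nat) (M : topologicalType).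
Variable A : smooth_atlas F n M.

Local Notation E := (M * 'rV[F]_m)%type.

Definition prod_dom (c : chart_index A) : set E := [set z | chart_dom c z.1].
Definition prod_chart (c : chart_index A) (z : E) : 'rV[F]_(n + m) :=
  row_mx (chart c z.1) z.2.
Definition prod_chart_inv (c : chart_index A) (x : 'rV[F]_(n + m)) : E :=
  (chart_inv c (lsubmx x), rsubmx x).

Lemma prod_cover (z : E) : exists c, prod_dom c z.
Proof. exact: chart_cover. Qed.

Lemma prod_dom_open c : open (prod_dom c).
Proof.
apply: (@open_comp _ _ fst); last exact: chart_dom_open.
by move=> z _; exact: cvg_fst.
Qed.

Lemma prod_img c : prod_chart c @` prod_dom c =
  [set x | (@chart _ _ _ A c @` @chart_dom _ _ _ A c) (lsubmx x)].
Proof.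
apply/seteqP; split=> [_ [z cz <-]|x [p cp px]] /=.
  by exists z.1 => //; rewrite row_mxKl.
by exists (p, rsubmx x) => //; rewrite /prod_chart /= px hsubmxK.
Qed.

Lemma prod_img_open c : open (prod_chart c @` prod_dom c).
Proof.
rewrite prod_img.
apply: (@open_comp _ _ (lsubmx : 'rV[F]_(n + m) -> 'rV[F]_n)).
  by move=> z _; exact: continuous_lsubmx.
exact: chart_img_open.
Qed.

Lemma prod_chartK c z : prod_dom c z -> prod_chart_inv c (prod_chart c z) = z.
Proof.
case: z => p y cp; rewrite /prod_chart_inv /prod_chart /=.
by rewrite row_mxKl row_mxKr chartK.
Qed.

Lemma prod_chart_continuous c z :
  prod_dom c z -> {for z, continuous (prod_chart c)}.
Proof.
move=> cz; apply: continuous_rowP => j; rewrite /prod_chart.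
case: (fintype.splitP j) => i ji.
  have -> : j = lshift m i by exact: val_inj.
  rewrite (_ : (fun q : E => _) = fun q => chart c q.1 0 i); last first.
    by apply/funext => q; rewrite row_mxEl.
  apply: (@continuous_comp _ _ _ fst (fun p => chart c p 0 i)).
    exact: cvg_fst.
  apply: (@continuous_comp _ _ _ (chart c) (fun p : 'rV[F]_n => p 0 i)).
    exact: chart_continuous.
  exact: coord_continuous.
have -> : j = rshift n i by exact: val_inj.
rewrite (_ : (fun q : E => _) = fun q => q.2 0 i); last first.
  by apply/funext => q; rewrite row_mxEr.
apply: (@continuous_comp _ _ _ snd (fun p : 'rV[F]_m => p 0 i)).
  exact: cvg_snd.
exact: coord_continuous.
Qed.

Lemma prod_chart_inv_continuous c z :
  prod_dom c z -> {for prod_chart c z, continuous (prod_chart_inv c)}.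
Proof.
move=> cz.
have lc : {for prod_chart c z, continuous (chart_inv c \o lsubmx)}.
  apply: continuous_comp; first exact: continuous_lsubmx.
  by rewrite row_mxKl; exact: chart_inv_continuous.
have rc : {for prod_chart c z,
    continuous (rsubmx : 'rV[F]_(n + m) -> 'rV[F]_m)}.
  exact: continuous_rsubmx.
exact: cvg_pair lc rc.
Qed.

Lemma prod_transition_smooth c c' (j : 'I_(n + m)) :
  smooth_on (prod_chart c @` (prod_dom c `&` prod_dom c'))
            (fun x => prod_chart c' (prod_chart_inv c x) 0 j).
Proof.
move=> k; rewrite /prod_chart /=; case: (fintype.splitP j) => i ji.
  have -> : j = lshift m i by exact: val_inj.
  rewrite (_ : (fun x => _) =
    (fun x => chart c' (chart_inv c x) 0 i) \o lsubmx); last first.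
    by apply/funext => x; rewrite row_mxEl.
  have := @chart_transition_smooth _ _ _ A c c' i k.
  move=> /(@Ck_lsubmx F n m) H; apply: Ck_sub H => _ [z [cz c'z] <-] /=.
  by exists z.1 => //; rewrite row_mxKl.
have -> : j = rshift n i by exact: val_inj.
rewrite (_ : (fun x => _) =
  fun x : 'rV[F]_(n + m) => x 0 (rshift n i)); last first.
  by apply/funext => x; rewrite row_mxEr mxE.
exact: Ck_coord.
Qed.

Definition prod_atlas : smooth_atlas F (n + m) E :=
  SmoothAtlas prod_cover prod_dom_open prod_img_open prod_chartK
    prod_chart_continuous prod_chart_inv_continuous prod_transition_smooth.

(* The pullback of a 1-form under the first projection. *)
Definition pull_fst (eta : local1 A) : local1 prod_atlas :=
  fun c z => row_mx (eta c z.1) 0.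

End Product.

Notation i1 := (@Ordinal 3 0 isT).
Notation i2 := (@Ordinal 3 1 isT).
Notation i3 := (@Ordinal 3 2 isT).

Section Structures.
Variables (F : realType) (Sigma : manifold F 3).
Implicit Types (R I J K : Sigma -> F) (alpha omega : 'I_3 -> local1 (matlas Sigma)).

Definition cartan_structure R alpha : Prop :=
  [/\ smooth_fun (matlas Sigma) R, coframing alpha &
   forall c p, chart_dom c p ->
    [/\ dform (alpha i1) c p = wedge (alpha i2 c p) (alpha i3 c p),
        dform (alpha i2) c p = - wedge (alpha i1 c p) (alpha i3 c p) &
        dform (alpha i3) c p = R p *: wedge (alpha i1 c p) (alpha i2 c p)]].

Definition finsler_structure I J K omega : Prop :=
  [/\ [/\ smooth_fun (matlas Sigma) I, smooth_fun (matlas Sigma) J &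
          smooth_fun (matlas Sigma) K], coframing omega &
   forall c p, chart_dom c p ->
    [/\ dform (omega i1) c p =
          - I p *: wedge (omega i1 c p) (omega i3 c p)
          + wedge (omega i2 c p) (omega i3 c p),
        dform (omega i2) c p = - wedge (omega i1 c p) (omega i3 c p) &
        dform (omega i3) c p =
          K p *: wedge (omega i1 c p) (omega i2 c p)
          - J p *: wedge (omega i1 c p) (omega i3 c p)]].

End Structures.

Section SystemS.
Variable F : realType.
(* The values of the functions R, I, J, K at a point, and the entries a_ij. *)
Variables (r cI cJ cK : F) (a : 'M[F]_3).

Definition minor (i j : 'I_3) : F := \det (row' i (col' j a)).

Definition B12 (i : 'I_3) : F := match val i with
  | 0 => a i1 i3 * r + cI * minor i2 i3 - minor i1 i3
  | 1 => a i2 i3 * r + minor i2 i3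
  | _ => a i3 i3 * r - cK * minor i3 i3 + cJ * minor i2 i3
  end.

Definition B23 (i : 'I_3) : F := match val i with
  | 0 => a i1 i1 + cI * minor i2 i1 - minor i1 i1
  | 1 => a i2 i1 + minor i2 i1
  | _ => a i3 i1 - cK * minor i3 i1 + cJ * minor i2 i1
  end.

Definition B31 (i : 'I_3) : F := match val i with
  | 0 => a i1 i2 - cI * minor i2 i2 + minor i1 i2
  | 1 => a i2 i2 - minor i2 i2
  | _ => a i3 i2 + cK * minor i3 i2 - cJ * minor i2 i2
  end.

(* [d i j k] stands for a_{ij.k}. *)
Definition system_S (d : 'I_3 -> 'I_3 -> 'I_3 -> F) : Prop :=
  forall i, [/\ d i i1 i2 = d i i2 i1 + B12 i,
                d i i3 i1 = d i i1 i3 + B31 i &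
                d i i2 i3 = d i i3 i2 + B23 i].

End SystemS.

(* The labels (j, k) of the free first-order coordinates a_{ij.k}, and of the
   forms Pi_{ijk}. *)
Notation s11 := (@Ordinal 6 0 isT).
Notation s21 := (@Ordinal 6 1 isT).
Notation s13 := (@Ordinal 6 2 isT).
Notation s22 := (@Ordinal 6 3 isT).
Notation s32 := (@Ordinal 6 4 isT).
Notation s33 := (@Ordinal 6 5 isT).

Definition jet (F : realType) (r cI cJ cK : F) (a : 'M[F]_3) (q : 'M[F]_(3, 6))
    (i j k : 'I_3) : F :=
  match val j, val k with
  | 0, 0 => q i s11
  | 0, 1 => q i s21 + B12 r cI cJ cK a i
  | 0, _ => q i s13
  | 1, 0 => q i s21
  | 1, 1 => q i s22
  | 1, _ => q i s32 + B23 cI cJ cK a i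
  | _, 0 => q i s13 + B31 cI cJ cK a i
  | _, 1 => q i s32
  | _, _ => q i s33
  end.

(* In the fibres of J^1(3,9), the equations (S) cut out the graph that is
   parametrized by the a_ij and the 18 free coordinates. *)
Lemma system_S_jet (F : realType) (r cI cJ cK : F) (a : 'M[F]_3)
    (d : 'I_3 -> 'I_3 -> 'I_3 -> F) :
  system_S r cI cJ cK a d <->
  exists q, forall i j k, d i j k = jet r cI cJ cK a q i j k.
Proof.
split=> [S|[q dq] i]; last by split; rewrite !dq.
pose s (m : 'I_6) : 'I_3 * 'I_3 := match val m with
  | 0 => (i1, i1) | 1 => (i2, i1) | 2 => (i1, i3)
  | 3 => (i2, i2) | 4 => (i3, i2) | _ => (i3, i3) end.
exists (\matrix_(i, m) d i (s m).1 (s m).2) => i j k.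
have [S12 S31 S23] := S i.
case: j => [[|[|[|//]]] hj]; case: k => [[|[|[|//]]] hk];
  rewrite /jet /= !mxE /= -?S12 -?S31 -?S23; congr (d i _ _); exact: val_inj.
Qed.

Section Pfaffian.
Variables (F : realType) (Sigma : manifold F 3) (R I J K : Sigma -> F).
Variable alpha : 'I_3 -> local1 (matlas Sigma).

(* The submanifold of J^1(3,9) defined by (S), in its fibre coordinates: the
   nine a_ij and the eighteen free a_{ij.k} (see [system_S_jet]). *)
Definition SigmaT : topologicalType := (Sigma * 'rV[F]_(3 * 3 + 3 * 6))%type.

Definition atlasT : smooth_atlas F (3 + (3 * 3 + 3 * 6)) SigmaT :=
  prod_atlas (3 * 3 + 3 * 6) (matlas Sigma).

Implicit Types (z : SigmaT) (c : chart_index atlasT).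

Definition acoord z : 'M[F]_3 := vec_mx (lsubmx z.2).
Definition qcoord z : 'M[F]_(3, 6) := vec_mx (rsubmx z.2).

(* The function a_{ij.k}. *)
Definition ajet (i j k : 'I_3) z : F :=
  jet (R z.1) (I z.1) (J z.1) (K z.1) (acoord z) (qcoord z) i j k.

Definition alphaT (k : 'I_3) : local1 atlasT :=
  pull_fst (m := 3 * 3 + 3 * 6) (alpha k).

Definition theta (i j : 'I_3) : local1 atlasT := fun c z =>
  dfun (A := atlasT) (fun w => acoord w i j) c z
  - \sum_k ajet i j k z *: alphaT k c z.

(* Congruence of 2-covectors at a point modulo the ideal of the theta_ij. *)
Definition cong_theta c z (X Y : 'M[F]_(3 + (3 * 3 + 3 * 6))) : Prop :=
  exists beta : 'I_3 -> 'I_3 -> 'rV[F]_(3 + (3 * 3 + 3 * 6)),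
    X = Y + \sum_i \sum_j wedge (beta i j) (theta i j c z).

(* The row of the G_{.k}.  When [G] only depends on the point of Sigma and on
   the a_ij, it exists and is unique, so that the default value [0] is not
   used. *)
Definition formal_deriv (G : SigmaT -> F) z : 'rV[F]_3 :=
  xget 0 [set v : 'rV[F]_3 | forall c, chart_dom c z ->
    exists h : 'M[F]_3,
      dfun (A := atlasT) G c z =
        \sum_k v 0 k *: alphaT k c z
        + \sum_i \sum_j h i j *: theta i j c z].

(* A_ij, A_{ij.k} and, for a function f on Sigma, f_k. *)
Definition Amin (i j : 'I_3) z : F := minor (acoord z) i j.
Definition Adot (i j k : 'I_3) z : F := formal_deriv (Amin i j) z 0 k.
Definition fder (f : Sigma -> F) (k : 'I_3) z : F :=
  frame_deriv alpha f z.1 0 k.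

(* T_{i3} *)
Definition torsion (i : 'I_3) z : F :=
  let S (l : 'I_3) := Adot l i3 i3 z + Adot l i1 i1 z - Adot l i2 i2 z in
  let D f (l : 'I_3) :=
    fder f i1 z * Amin l i1 z - fder f i2 z * Amin l i2 z
    + fder f i3 z * Amin l i3 z in
  match val i with
  | 0 => - S i1 + I z.1 * S i2 + D I i2
  | 1 => S i2
  | _ => - K z.1 * S i3 + J z.1 * S i2 - D K i3 + D J i2
  end.

(* The structure equations of d(theta_i1), d(theta_i2), d(theta_i3) at the point
   [z], for the values [P] of the Pi_{ijk} at [z] and the torsion [t]. *)
Definition structure_eqs (i : 'I_3) c z
    (P : 'I_6 -> 'rV[F]_(3 + (3 * 3 + 3 * 6))) (t : F) : Prop :=
  let a1 := alphaT i1 c z in let a2 := alphaT i2 c z in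
  let a3 := alphaT i3 c z in
  [/\ cong_theta c z (dform (theta i i1) c z)
        (wedge (P s11) a1 + wedge (P s21) a2 + wedge (P s13) a3),
      cong_theta c z (dform (theta i i2) c z)
        (wedge (P s21) a1 + wedge (P s22) a2 + wedge (P s32) a3) &
      cong_theta c z (dform (theta i i3) c z)
        (wedge (P s13) a1 + wedge (P s32) a2 + wedge (P s33) a3
         + t *: wedge a1 a2)].

Definition indep_mod (Pi : 'I_3 -> 'I_6 -> local1 atlasT) : Prop :=
  forall c z, chart_dom c z ->
  forall (x : 'M[F]_(3, 6)) (y : 'M[F]_3) (w : 'rV[F]_3),
    \sum_i \sum_m x i m *: Pi i m c z =
      \sum_i \sum_j y i j *: theta i j c z + \sum_k w 0 k *: alphaT k c z ->
    x = 0.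

(* At [z], the term T_{i3} alpha^1 /\ alpha^2 can be removed by adding
   combinations of the alpha's to the Pi_{ijk}. *)
Definition absorbable (Pi : 'I_3 -> 'I_6 -> local1 atlasT) (i : 'I_3) z : Prop :=
  exists s : 'M[F]_(6, 3), forall c, chart_dom c z ->
    structure_eqs i c z
      (fun m => Pi i m c z + \sum_k s m k *: alphaT k c z) 0.

End Pfaffian.

(* Main.v *)
Require Import Defs.
From mathcomp Require Import all_boot all_order all_algebra.
From mathcomp Require Import all_classical all_reals all_analysis.
From mathcomp Require Import ring lra.

Set Implicit Arguments.
Unset Strict Implicit.
Unset Printing Implicit Defensive.

Import Order.TTheory GRing.Theory Num.Theory numFieldNormedType.Exports.
Local Open Scope classical_set_scope.
Local Open Scope ring_scope.

(** The forms theta_ij are da_ij - sum_k a_ij.k alpha^k, and d(da_ij) = 0, so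
    d theta_ij = - sum_k (d(a_ij.k) /\ alpha^k + a_ij.k d alpha^k). Each a_ij.k is
    a free coordinate q or, if (S) expresses it by another one, the sum of a
    free coordinate q and a function B of the point and of the a_ij. Modulo the
    theta's, dB is a combination of the alpha's whose coefficients are the
    formal derivatives of B; hence d theta_ij is a combination of the dq /\
    alpha^k and of the alpha^k /\ alpha^l.

    Put Pi = - dq + (a combination of the alpha's). For each i the free
    coordinates are arranged in a symmetric matrix, so that the nine
    coefficients of the alpha^k /\ alpha^l in d theta_i1, d theta_i2, d theta_i3
    can be absorbed in the Pi's except for one combination: the sum of the
    coefficients of alpha^2 /\ alpha^3 in d theta_i1, of alpha^3 /\ alpha^1 in
    d theta_i2 and of alpha^1 /\ alpha^2 in d theta_i3.
    This sum is the torsion T_i3. It does not depend on the Pi's: it is computed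
    by evaluating the d theta_ij on the vectors that annihilate the theta's and
    are dual to the alpha's, and there the Pi's cancel by symmetry
    ([structure_eqs_torsion]). Conversely, an explicit choice of the
    combinations of the alpha's ([absorber]) leaves T_i3 as the only remaining
    term ([structure_eqs_Pi]). So T_i3 can be absorbed only where it is 0
    ([absorbable_Pi]).

    To find the value of T_i3, write d omega^i = - (N_i1 alpha^2 /\ alpha^3 +
    N_i2 alpha^1 /\ alpha^3 + N_i3 alpha^1 /\ alpha^2) for omega = A alpha; the
    N_il are linear in the minors of A, with coefficients 1, I, J, K up to sign.
    In (S) one has B_i12 = a_i3 R + N_i3, B_i23 = a_i1 + N_i1 and B_i31 =
    a_i2 - N_i2. In the sum above, the terms in the a_ij.k cancel against the
    a_ij.k of the d alpha^k, and there remains T_i3 = N_i3.3 + N_i1.1 - N_i2.2 +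
    a_i3 R_3. The last term is 0 by the Bianchi identity R_3 = 0 ([bianchi]),
    which is d(d alpha^3) = 0.

    Both d(da_ij) = 0 and d(d alpha^3) = 0 rest on the symmetry of second
    partial derivatives ([schwarz]). That the Pi's are smooth forms on the whole
    manifold needs the coefficients of df in the coframing to be smooth
    ([smooth_frame_deriv]) and every minor to have smooth formal derivatives
    ([total_deriv_Amin]). *)

(** * Partial derivatives *)

(** Near x, the difference of the two functions is 0, hence an o of anything. *)
Lemma near_eq_differentiable (K : numFieldType) (V W : normedModType K)
    (f g : V -> W) (x : V) :
  (\forall y \near x, f y = g y) -> differentiable f x -> differentiable g x.
Proof.
move=> fg df.
suff dh : differentiable (g - f) x.
  rewrite (_ : g = (g - f) + f); first exact: differentiableD.
  by apply/funext => y; rewrite -[RHS]/((g y - f y) + f y) subrK.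
have h0 : g x - f x = 0 by rewrite (nbhs_singleton fg) subrr.
have H : (g - f) \o shift x = cst ((g - f) x) + (0 : V -> W) +o_ 0 id.
  apply/eqaddoP => e e0; have := fg; rewrite (near_shift 0) subr0 => fg0.
  near=> h.
  rewrite [X in `|X| <= _](_ : _ = 0); first by rewrite normr0 mulr_ge0// ltW.
  have fgh : f (h + x) = g (h + x) by near: h; move: fg0.
  rewrite /= /cst; rewrite -[LHS]/((g (h + x) - f (h + x)) - ((g x - f x) + 0)).
  by rewrite h0 addr0 subr0 fgh subrr.
have c0 : continuous (0 : V -> W) by apply: cst_continuous.
apply/diff_locallyP.
have E := @diff_unique _ _ _ (g - f) _ x c0 H.
by rewrite E; split.
Unshelve. all: by end_near. Qed.

Section PartialDerivatives.
Variables (F : realType) (n : nat).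
Implicit Types (U : set 'rV[F]_n) (f g : 'rV[F]_n -> F) (x : 'rV[F]_n).

Lemma near_eq_pd l f g x : (\forall y \near x, f y = g y) ->
  pd l f x = pd l g x.
Proof. exact: near_eq_derive. Qed.

Lemma pdE l f x : differentiable f x -> pd l f x = 'd f x (delta_mx 0 l).
Proof. exact: deriveE. Qed.

Lemma pd_cst l (a : F) x : pd l (fun=> a) x = 0.
Proof. exact: derive_cst. Qed.

Lemma pdD l f g x : differentiable f x -> differentiable g x ->
  pd l (fun y => f y + g y) x = pd l f x + pd l g x.
Proof. by move=> df dg; apply: deriveD; exact: diff_derivable. Qed.

Lemma pdB l f g x : differentiable f x -> differentiable g x ->
  pd l (fun y => f y - g y) x = pd l f x - pd l g x.
Proof. by move=> df dg; apply: deriveB; exact: diff_derivable. Qed.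

Lemma pdM l f g x : differentiable f x -> differentiable g x ->
  pd l (fun y => f y * g y) x = pd l f x * g x + f x * pd l g x.
Proof.
move=> df dg; rewrite /pd.
rewrite deriveM; try exact: diff_derivable.
by rewrite addrC [X in X + _ = _]mulrC.
Qed.

Lemma pdV l f x : f x != 0 -> differentiable f x ->
  pd l (fun y => (f y)^-1) x = - pd l f x * (f x)^-1 ^+ 2.
Proof.
move=> f0 df; rewrite /pd (deriveV f0); last exact: diff_derivable.
by rewrite -exprVn -[_ *: _]/(_ * _) mulrC mulrN mulNr.
Qed.

End PartialDerivatives.

(** * Functions of class C^k on an open set *)

Section ClassCk.
Variables (F : realType) (n : nat).
Implicit Types (U : set 'rV[F]_n) (f g : 'rV[F]_n -> F) (x : 'rV[F]_n).

Lemma Ck_differentiable k U f x : Ck k.+1 U f -> U x -> differentiable f x.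
Proof. by case=> df _ /df. Qed.

Lemma CkW k U f : Ck k.+1 U f -> Ck k U f.
Proof.
elim: k f => [|k IH] f [df pf].
  by move=> x /df; exact: differentiable_continuous.
by split=> // l; exact: IH.
Qed.

(** [Ck] differentiates total functions, so that a change of the function
    outside U is harmless only because U is open. *)
Lemma Ck_ext k U f g : open U -> (forall x, U x -> f x = g x) ->
  Ck k U f -> Ck k U g.
Proof.
move=> oU; have near_eq h h' : (forall x, U x -> h x = h' x) ->
    forall x, U x -> \forall y \near x, h y = h' y.
  by move=> hh' x Ux; near do apply: hh'; exact: open_nbhs_nbhs.
elim: k f g => [|k IH] f g fg /=.
  move=> cf x Ux; rewrite /prop_for /continuous_at -(fg x Ux).
  have fgx := near_eq _ _ _ fg x Ux.
  apply: (@cvg_trans _ (f @ nbhs x)) (cf x Ux).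
  exact: near_eq_cvg fgx.
move=> [df pf]; split=> [x Ux|l].
  exact: near_eq_differentiable (near_eq _ _ _ fg x Ux) (df x Ux).
by apply: IH (pf l) => x Ux; apply: near_eq_pd; exact: near_eq.
Unshelve. all: by end_near. Qed.

Lemma CkD k U f g : open U -> Ck k U f -> Ck k U g ->
  Ck k U (fun x => f x + g x).
Proof.
move=> oU; elim: k f g => [|k IH] f g /=.
  by move=> cf cg x Ux; apply: continuousD; [exact: cf|exact: cg].
move=> [df pf] [dg pg]; split=> [x Ux|l].
  by apply: differentiableD; [exact: df|exact: dg].
apply: (Ck_ext (f := fun x => pd l f x + pd l g x)) => //; last exact: IH.
by move=> x Ux; rewrite pdD//; [exact: df|exact: dg].
Qed.

Lemma CkM k U f g : open U -> Ck k U f -> Ck k U g ->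
  Ck k U (fun x => f x * g x).
Proof.
move=> oU; elim: k f g => [|k IH] f g /=.
  by move=> cf cg x Ux; apply: continuousM; [exact: cf|exact: cg].
move=> Cf Cg; have [df pf] := Cf; have [dg pg] := Cg; split=> [x Ux|l].
  by apply: differentiableM; [exact: df|exact: dg].
apply: (Ck_ext (f := fun x => pd l f x * g x + f x * pd l g x)) => //.
  by move=> x Ux; rewrite pdM//; [exact: df|exact: dg].
by apply: CkD => //; apply: IH => //; exact: CkW.
Qed.

Lemma CkV k U f : open U -> (forall x, U x -> f x != 0) -> Ck k U f ->
  Ck k U (fun x => (f x)^-1).
Proof.
move=> oU f0; elim: k => [|k IH] /=.
  by move=> cf x Ux; apply: continuousV; [exact: f0|exact: cf].
move=> Cf; have [df pf] := Cf; split=> [x Ux|l].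
  by apply: differentiableV; [exact: df|exact: f0].
have CV := IH (CkW Cf).
apply: (Ck_ext (f := fun x => -1 * (pd l f x * ((f x)^-1 * (f x)^-1)))) => //.
  by move=> x Ux; rewrite pdV ?f0//; [rewrite expr2 mulN1r mulNr|exact: df].
by apply: CkM => //; [exact: Ck_cst|apply: CkM => //; exact: CkM].
Qed.

Lemma smooth_differentiable U f x : smooth_on U f -> U x -> differentiable f x.
Proof. by move=> sf Ux; exact: (Ck_differentiable (sf 1%N)). Qed.

Lemma smooth_pd U f l : smooth_on U f -> smooth_on U (pd l f).
Proof. by move=> sf k; have [_ psf] := sf k.+1; exact: psf. Qed.

End ClassCk.

(** * Chain rule and symmetry of second derivatives *)

Section ChainRule.
Variables (F : realType) (n m : nat).

Lemma differentiable_rowP (phi : 'rV[F]_n -> 'rV[F]_m) x :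
  (forall k, differentiable (fun y => phi y 0 k) x) -> differentiable phi x.
Proof.
move=> dphi.
rewrite (_ : phi = \sum_(k < m) (fun y => phi y 0 k *: delta_mx 0 k)).
  by apply: differentiable_sum => k; exact: differentiableZl.
by apply/funext => y; rewrite fct_sumE; exact: row_sum_delta.
Qed.

Lemma pd_comp (g : 'rV[F]_m -> F) (phi : 'rV[F]_n -> 'rV[F]_m) x l :
  (forall k, differentiable (fun y => phi y 0 k) x) ->
  differentiable g (phi x) ->
  pd l (g \o phi) x =
  \sum_k pd k g (phi x) * pd l (fun y => phi y 0 k) x.
Proof.
move=> dphik dg; have dphi := differentiable_rowP dphik.
rewrite pdE; last exact: differentiable_comp.
rewrite diff_comp//= -(deriveE _ dphi) derive_mx; last exact: diff_derivable.
set u := (\matrix_(_, _) _).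
rewrite [u]row_sum_delta linear_sum; apply: eq_bigr => k _.
by rewrite linearZ /= -pdE// mulrC !mxE.
Qed.

End ChainRule.

Section Schwarz.
Variables (F : realType) (n : nat).
Implicit Types (U : set 'rV[F]_n) (f : 'rV[F]_n -> F) (x : 'rV[F]_n).

Lemma is_derive_line f x (k : 'I_n) (t : F) :
  differentiable f (x + t *: delta_mx 0 k) ->
  is_derive t 1 (fun s : F => f (x + s *: delta_mx 0 k))
                (pd k f (x + t *: delta_mx 0 k)).
Proof.
move=> df; have E : (fun h : F => h^-1 *:
    (((fun s : F => f (x + s *: delta_mx 0 k)) \o shift t) (h *: 1)
     - f (x + t *: delta_mx 0 k))) =
    (fun h : F => h^-1 *: ((f \o shift (x + t *: delta_mx 0 k))
       (h *: delta_mx 0 k) - f (x + t *: delta_mx 0 k))).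
  apply/funext => h /=; congr (_ *: (f _ - _)).
  by rewrite -[h *: 1]/(h * 1) mulr1 scalerDl addrCA.
by apply: DeriveDef; rewrite /derivable /derive E//; exact: diff_derivable df.
Qed.

Lemma line_MVT f x (k : 'I_n) (h : F) : 0 < h ->
  (forall t, 0 <= t <= h -> differentiable f (x + t *: delta_mx 0 k)) ->
  exists2 t, 0 <= t <= h &
    f (x + h *: delta_mx 0 k) - f x = pd k f (x + t *: delta_mx 0 k) * h.
Proof.
move=> h0 df.
have [phi ephi] : {phi : F -> F | phi = fun s => f (x + s *: delta_mx 0 k)}.
  by eexists.
have [psi epsi] :
    {psi : F -> F | psi = fun s => pd k f (x + s *: delta_mx 0 k)}.
  by eexists.
have dphi t : 0 <= t <= h -> is_derive t 1 phi (psi t).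
  by rewrite ephi epsi => /df; exact: is_derive_line.
have dphio t : t \in `]0, h[ -> is_derive t 1 phi (psi t).
  by rewrite in_itv /= => /andP[t0 th]; apply: dphi; rewrite !ltW.
have cphi : {within `[0, h], continuous phi}.
  apply: derivable_within_continuous => t; rewrite in_itv /= => th.
  by have [] := dphi _ th.
have [t] := MVT h0 dphio cphi.
rewrite in_itv /= => /andP[t0 th].
rewrite ephi epsi scale0r addr0 subr0 => E.
by exists t; rewrite ?ltW.
Qed.

Fact mixed_differences (a b c d p q h : F) : h != 0 ->
  a - b - c + d = p * h * h -> a - c - b + d = q * h * h -> q = p.
Proof.
move=> h0 Ep Eq; apply: (mulIf h0); apply: (mulIf h0).
by rewrite -Ep -Eq; ring.
Qed.

(** The second difference of f along two coordinate directions is symmetric in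
    them, and two applications of the mean value theorem turn it into a value of
    either mixed derivative. *)
Lemma second_difference f x (k l : 'I_n) (h : F) : 0 < h ->
  (forall s t, 0 <= s <= h -> 0 <= t <= h ->
    differentiable f (x + s *: delta_mx 0 k + t *: delta_mx 0 l)
    /\ differentiable (pd k f) (x + s *: delta_mx 0 k + t *: delta_mx 0 l)) ->
  exists s t, [/\ 0 <= s <= h, 0 <= t <= h &
    f (x + h *: delta_mx 0 k + h *: delta_mx 0 l) - f (x + h *: delta_mx 0 l)
    - f (x + h *: delta_mx 0 k) + f x =
    pd l (pd k f) (x + s *: delta_mx 0 k + t *: delta_mx 0 l) * h * h].
Proof.
move=> h0 df; have hh : 0 <= h <= h by rewrite lexx ltW.
have h00 : (0 : F) <= 0 <= h by rewrite lexx ltW.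
pose D := fun y => f (y + h *: delta_mx 0 l) - f y.
have dt s : 0 <= s <= h ->
    differentiable (fun y => f (y + h *: delta_mx 0 l)) (x + s *: delta_mx 0 k).
  move=> sh; pose tr := (id : 'rV[F]_n -> _) + cst (h *: delta_mx 0 l).
  have di : differentiable (id : 'rV[F]_n -> 'rV[F]_n) (x + s *: delta_mx 0 k).
    exact: ex_diff.
  have dtr : differentiable tr (x + s *: delta_mx 0 k).
    exact: differentiableD di (differentiable_cst _ _).
  have dft : differentiable f (tr (x + s *: delta_mx 0 k)).
    by have [] := df s h sh hh.
  exact: differentiable_comp dtr dft.
have d0 s : 0 <= s <= h -> differentiable f (x + s *: delta_mx 0 k).
  by move=> sh; have [] := df s 0 sh h00; rewrite scale0r addr0.
have [|s sh Es] := @line_MVT D x k h h0.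
  by move=> s sh; apply: differentiableB; [exact: dt|exact: d0].
have [|t th Et] := @line_MVT (pd k f) (x + s *: delta_mx 0 k) l h h0.
  by move=> t th; case: (df s t sh th).
exists s, t; split=> //.
have pdt y : pd k (fun y => f (y + h *: delta_mx 0 l)) y =
    pd k f (y + h *: delta_mx 0 l).
  rewrite /pd /derive; apply: (congr1 (fun g : F -> F => lim (g @ 0^'))).
  apply/funext => e /=.
  by rewrite addrA.
move: Es; rewrite /D pdB ?pdt ?Et; [|exact: dt|exact: d0].
by move=> <-; ring.
Qed.

(** On a small box at x the two mixed derivatives take a common value, at
    two points that may differ; both are continuous at x. *)
Lemma schwarz U f x (k l : 'I_n) : open U -> U x -> Ck 2 U f ->
  pd k (pd l f) x = pd l (pd k f) x.
Proof.
move=> oU Ux C2; have [df pdf] := C2.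
have cf a b : {for x, continuous (pd a (pd b f))}.
  by have [_ ppf] := pdf b; exact: ppf.
apply/eqP; rewrite -subr_eq0 -normr_le0; apply/ler_addgt0Pl => e e0.
rewrite addr0.
have e2 : 0 < e / 2 by rewrite divr_gt0.
have cb a b : \forall y \near x,
    ball (pd a (pd b f) x) (e / 2) (pd a (pd b f) y).
  by apply: (cf a b); exact: nbhsx_ballx.
clear cf.
have [r r0 br] : exists2 r, 0 < r & forall y, ball x r y -> [/\ U y,
    ball (pd k (pd l f) x) (e / 2) (pd k (pd l f) y) &
    ball (pd l (pd k f) x) (e / 2) (pd l (pd k f) y)].
  have c0 : \forall y \near x, U y by exact: open_nbhs_nbhs (conj oU Ux).
  have c3 := filterI c0 (filterI (cb k l) (cb l k) : nbhs x _).
  have [r r0 br] := (nbhs_ballP _ _).1 (c3 (nbhs_filter x) (nbhs_filter x)).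
  by exists r => // y /br [? []].
clear cb.
have r4 : 0 < r / 4 by rewrite divr_gt0.
have br' a b s t : 0 <= s <= r / 4 -> 0 <= t <= r / 4 ->
    ball x r (x + s *: delta_mx 0 a + t *: delta_mx 0 b).
  move=> /andP[s0 s4] /andP[t0 t4]; split=> // i j; rewrite !mxE.
  rewrite /ball /= -addrA opprD addrA subrr add0r normrN.
  have bb (c : bool) : 0 <= c%:R :> F /\ c%:R <= 1 :> F by case: c.
  have [? ?] := bb ((i == 0) && (j == a)).
  have [? ?] := bb ((i == 0) && (j == b)).
  have ? : s * ((i == 0) && (j == a))%:R <= s by rewrite ler_piMr.
  have ? : t * ((i == 0) && (j == b))%:R <= t by rewrite ler_piMr.
  rewrite ger0_norm ?addr_ge0 ?mulr_ge0//; lra.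
have dd a b s t : 0 <= s <= r / 4 -> 0 <= t <= r / 4 ->
    differentiable f (x + s *: delta_mx 0 a + t *: delta_mx 0 b) /\
    differentiable (pd a f) (x + s *: delta_mx 0 a + t *: delta_mx 0 b).
  move=> sr tr; have [Uy _ _] := br _ (br' a b s t sr tr).
  by split; [exact: df|have [d _] := pdf a; exact: d].
have [s [t [sr tr Ekl]]] := @second_difference f x k l _ r4 (dd k l).
have [s' [t' [sr' tr' Elk]]] := @second_difference f x l k _ r4 (dd l k).
have [_ _ G] := br _ (br' k l _ _ sr tr).
have [_ H _] := br _ (br' l k _ _ sr' tr').
have r40 : r / 4 != 0 by rewrite gt_eqF.
rewrite [x + _ + _ in LHS]addrAC in Elk.
have EE : pd k (pd l f) (x + s' *: delta_mx 0 l + t' *: delta_mx 0 k) =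
    pd l (pd k f) (x + s *: delta_mx 0 k + t *: delta_mx 0 l).
  by apply: mixed_differences r40 Ekl Elk.
clear Ekl Elk dd br'.
rewrite EE in H; rewrite /ball /= in G H.
set a := pd k _ x in H *; set b := pd l _ x in G *.
set c := pd l _ _ in G H.
rewrite (_ : a - b = (a - c) - (b - c)); last by ring.
apply: le_trans (ler_normB _ _) _; rewrite [e]splitr; apply: ltW.
exact: ltrD H G.
Qed.

End Schwarz.

(** * Smooth functions and forms in charts *)

Section SmoothOn.
Variables (F : realType) (n : nat) (U : set 'rV[F]_n).
Hypothesis oU : open U.
Implicit Types (f g : 'rV[F]_n -> F).

Lemma smooth_on_ext f g : (forall x, U x -> f x = g x) ->
  smooth_on U f -> smooth_on U g.
Proof. by move=> fg sf k; apply: Ck_ext fg (sf k). Qed.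

Lemma smooth_on_cst (a : F) : smooth_on U (fun=> a).
Proof. by move=> k; exact: Ck_cst. Qed.

Lemma smooth_onD f g : smooth_on U f -> smooth_on U g ->
  smooth_on U (fun x => f x + g x).
Proof. by move=> sf sg k; exact: CkD. Qed.

Lemma smooth_onM f g : smooth_on U f -> smooth_on U g ->
  smooth_on U (fun x => f x * g x).
Proof. by move=> sf sg k; exact: CkM. Qed.

Lemma smooth_onV f : (forall x, U x -> f x != 0) -> smooth_on U f ->
  smooth_on U (fun x => (f x)^-1).
Proof. by move=> f0 sf k; exact: CkV. Qed.

Lemma smooth_onN f : smooth_on U f -> smooth_on U (fun x => - f x).
Proof.
move=> sf; apply: (smooth_on_ext (f := fun x => -1 * f x)).
  by move=> x _; rewrite mulN1r.
by apply: smooth_onM => //; exact: smooth_on_cst.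
Qed.

Lemma smooth_on_sum (I : Type) (r : seq I) (f : I -> 'rV[F]_n -> F) :
  (forall i, smooth_on U (f i)) -> smooth_on U (fun x => \sum_(i <- r) f i x).
Proof.
move=> sf; elim: r => [|i r IH].
  apply: (smooth_on_ext (f := fun=> 0)); last exact: smooth_on_cst.
  by move=> x _; rewrite big_nil.
apply: (smooth_on_ext (f := fun x => f i x + \sum_(i <- r) f i x)).
  by move=> x _; rewrite big_cons.
exact: smooth_onD.
Qed.

Lemma smooth_on_prod (I : Type) (r : seq I) (f : I -> 'rV[F]_n -> F) :
  (forall i, smooth_on U (f i)) -> smooth_on U (fun x => \prod_(i <- r) f i x).
Proof.
move=> sf; elim: r => [|i r IH].
  apply: (smooth_on_ext (f := fun=> 1)); last exact: smooth_on_cst.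
  by move=> x _; rewrite big_nil.
apply: (smooth_on_ext (f := fun x => f i x * \prod_(i <- r) f i x)).
  by move=> x _; rewrite big_cons.
exact: smooth_onM.
Qed.

Lemma smooth_on_det m (X : 'rV[F]_n -> 'M[F]_m) :
  (forall i j, smooth_on U (fun x => X x i j)) ->
  smooth_on U (fun x => \det (X x)).
Proof.
move=> sX; apply: smooth_on_sum => s; apply: smooth_onM.
  exact: smooth_on_cst.
by apply: smooth_on_prod => i; exact: sX.
Qed.

Lemma smooth_on_invmx m (X : 'rV[F]_n -> 'M[F]_m) :
  (forall x, U x -> X x \in unitmx) ->
  (forall i j, smooth_on U (fun x => X x i j)) ->
  forall i j, smooth_on U (fun x => invmx (X x) i j).
Proof.
move=> uX sX i j.
apply: (smooth_on_ext (f := fun x => (\det (X x))^-1 * cofactor (X x) j i)).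
  by move=> x Ux; rewrite /invmx uX// !mxE.
apply: smooth_onM.
  apply: smooth_onV; last exact: smooth_on_det.
  by move=> x /uX; rewrite unitmxE unitfE.
apply: smooth_onM; first exact: smooth_on_cst.
apply: smooth_on_det => k l.
apply: (smooth_on_ext (f := fun x => X x (lift j k) (lift i l))).
  by move=> x _; rewrite !mxE.
exact: sX.
Qed.

End SmoothOn.

Section FormCalculus.
Variables (F : realType) (n : nat) (M : topologicalType).
Variable A : smooth_atlas F n M.
Implicit Types (c : chart_index A) (f g : M -> F) (eta zeta : local1 A) (p : M).

Lemma chart_img_mem c p : chart_dom c p -> chart_img c (chart c p).
Proof. by move=> cp; exists p. Qed.

Lemma open_chart_img c : open (chart_img c).
Proof. exact: chart_img_open. Qed.

Lemma chart_invK c x : chart_img c x ->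
  chart_dom c (chart_inv c x) /\ chart c (chart_inv c x) = x.
Proof. by case=> p cp <-; rewrite chartK. Qed.

Lemma near_chart_img c p (P : 'rV[F]_n -> Prop) : chart_dom c p ->
  (forall x, chart_img c x -> P x) -> \forall x \near chart c p, P x.
Proof.
move=> cp HP; have ic := chart_img_mem cp.
have := open_nbhs_nbhs (conj (open_chart_img (c := c)) ic).
exact: filterS HP.
Qed.

Lemma smooth_fun_cst (a : F) : smooth_fun A (fun=> a).
Proof. by move=> c; exact: smooth_on_cst. Qed.

Lemma smooth_funD f g : smooth_fun A f -> smooth_fun A g ->
  smooth_fun A (fun p => f p + g p).
Proof.
by move=> sf sg c; apply: (smooth_onD (open_chart_img (c := c)) (sf c) (sg c)).
Qed.

Lemma smooth_funM f g : smooth_fun A f -> smooth_fun A g ->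
  smooth_fun A (fun p => f p * g p).
Proof.
by move=> sf sg c; apply: (smooth_onM (open_chart_img (c := c)) (sf c) (sg c)).
Qed.

Lemma smooth_funN f : smooth_fun A f -> smooth_fun A (fun p => - f p).
Proof.
by move=> sf c; apply: (smooth_onN (open_chart_img (c := c)) (sf c)).
Qed.

Lemma smooth_fun_differentiable f c p : smooth_fun A f -> chart_dom c p ->
  differentiable (f \o chart_inv c) (chart c p).
Proof.
by move=> sf cp; apply: (smooth_differentiable (sf c)); exact: chart_img_mem.
Qed.

Lemma dfun_cst (a : F) c p : dfun (fun=> a) c p = 0.
Proof. by apply/rowP => l; rewrite !mxE; exact: pd_cst. Qed.

Lemma dfunD f g c p : smooth_fun A f -> smooth_fun A g -> chart_dom c p ->
  dfun (fun q => f q + g q) c p = dfun f c p + dfun g c p.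
Proof.
move=> sf sg cp; apply/rowP => l; rewrite !mxE.
exact: (pdD l (smooth_fun_differentiable sf cp)
  (smooth_fun_differentiable sg cp)).
Qed.

Lemma dfunM f g c p : smooth_fun A f -> smooth_fun A g -> chart_dom c p ->
  dfun (fun q => f q * g q) c p = g p *: dfun f c p + f p *: dfun g c p.
Proof.
move=> sf sg cp; apply/rowP => l; rewrite !mxE.
have := pdM l (smooth_fun_differentiable sf cp)
  (smooth_fun_differentiable sg cp).
by rewrite /= chartK// [_ * g p]mulrC; apply.
Qed.

Lemma transition_differentiable c c' p k : chart_dom c p -> chart_dom c' p ->
  differentiable (fun x => chart c' (chart_inv c x) 0 k) (chart c p).
Proof.
move=> cp c'p; apply: (smooth_differentiable (chart_transition_smooth c c' k)).
by exists p.
Qed.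

(** The chain rule, for the change of coordinates from c to c'. *)
Lemma dfun_transition f c c' p : smooth_fun A f ->
  chart_dom c p -> chart_dom c' p -> dfun f c p = dfun f c' p *m jac c c' p.
Proof.
move=> sf cp c'p; apply/rowP => l; rewrite !mxE.
pose phi x := chart c' (chart_inv c x).
have fphi : \forall x \near chart c p,
    (f \o chart_inv c) x = ((f \o chart_inv c') \o phi) x.
  have c'near : \forall x \near chart c p, chart_dom c' (chart_inv c x).
    apply: (chart_inv_continuous cp); apply: open_nbhs_nbhs.
    by split; [exact: chart_dom_open|rewrite chartK].
  by apply: filterS c'near => x c'x; rewrite /= /phi chartK.
rewrite (near_eq_pd l fphi) pd_comp.
- by apply: eq_bigr => k _; rewrite !mxE /phi chartK.
- by move=> k; exact: transition_differentiable.
- by rewrite /phi chartK//; exact: smooth_fun_differentiable.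
Qed.

Lemma one_form_dfun f : smooth_fun A f -> one_form (dfun (A := A) f).
Proof.
move=> sf; split; last by move=> c c' p; exact: dfun_transition.
move=> c j; have := smooth_pd j (sf c).
apply: smooth_on_ext; first exact: open_chart_img.
by move=> x /chart_invK[_ cx]; rewrite mxE cx.
Qed.

Lemma one_formD eta zeta : one_form eta -> one_form zeta ->
  one_form ((fun c p => eta c p + zeta c p) : local1 A).
Proof.
move=> [se te] [sz tz]; split=> [c j|c c' p cp c'p].
  have := smooth_onD (open_chart_img (c := c)) (se c j) (sz c j).
  by apply: smooth_on_ext => [|x _]; [exact: open_chart_img|rewrite mxE].
by rewrite (te c c')// (tz c c')// mulmxDl.
Qed.

Lemma one_formZ f eta : smooth_fun A f -> one_form eta ->
  one_form ((fun c p => f p *: eta c p) : local1 A).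
Proof.
move=> sf [se te]; split=> [c j|c c' p cp c'p].
  have := smooth_onM (open_chart_img (c := c)) (sf c) (se c j).
  by apply: smooth_on_ext => [|x _]; [exact: open_chart_img|rewrite mxE].
by rewrite (te c c')// scalemxAl.
Qed.

Lemma one_form0 : one_form ((fun _ _ => 0) : local1 A).
Proof.
split=> [c j|c c' p _ _]; last by rewrite mul0mx.
apply: (smooth_on_ext (open_chart_img (c := c)) (f := fun=> 0)).
  by move=> x _; rewrite mxE.
exact: smooth_on_cst.
Qed.

Lemma one_form_sum (I : Type) (r : seq I) (eta : I -> local1 A) :
  (forall i, one_form (eta i)) ->
  one_form ((fun c p => \sum_(i <- r) eta i c p) : local1 A).
Proof.
move=> oe; elim: r => [|i r IH].
  rewrite (_ : (fun _ _ => _) = fun _ _ => 0); first exact: one_form0.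
  by apply/funext => c; apply/funext => p; rewrite big_nil.
rewrite (_ : (fun _ _ => _) =
    fun c p => eta i c p + \sum_(i <- r) eta i c p); first exact: one_formD.
by apply/funext => c; apply/funext => p; rewrite big_cons.
Qed.

Lemma one_formN eta :
  one_form eta -> one_form ((fun c p => - eta c p) : local1 A).
Proof.
move=> oe; rewrite (_ : (fun _ _ => _) = fun c p => (fun=> -1) p *: eta c p).
  by apply: one_formZ => //; exact: smooth_fun_cst.
by apply/funext => c; apply/funext => p; rewrite scaleN1r.
Qed.

Lemma one_form_differentiable eta c p j : one_form eta -> chart_dom c p ->
  differentiable (fun x => eta c (chart_inv c x) 0 j) (chart c p).
Proof.
move=> [se _] cp; apply: (smooth_differentiable (se c j)).
exact: chart_img_mem.
Qed.

Lemma dformD eta zeta c p : one_form eta -> one_form zeta -> chart_dom c p ->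
  dform ((fun c p => eta c p + zeta c p) : local1 A) c p =
  dform eta c p + dform zeta c p.
Proof.
move=> oe oz cp; apply/matrixP => k l; rewrite !mxE.
have E (a b : 'I_n) : pd a (fun x =>
      (eta c (chart_inv c x) + zeta c (chart_inv c x)) 0 b) (chart c p) =
    pd a (fun x => eta c (chart_inv c x) 0 b) (chart c p) +
    pd a (fun x => zeta c (chart_inv c x) 0 b) (chart c p).
  rewrite -pdD; [|exact: one_form_differentiable..].
  by apply: near_eq_pd; apply: near_chart_img => // x _; rewrite mxE.
by rewrite !E opprD addrACA.
Qed.

Lemma dformZ f eta c p : smooth_fun A f -> one_form eta -> chart_dom c p ->
  dform ((fun c p => f p *: eta c p) : local1 A) c p =
  wedge (dfun f c p) (eta c p) + f p *: dform eta c p.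
Proof.
move=> sf oe cp; apply/matrixP => k l; rewrite !mxE.
have E (a b : 'I_n) : pd a (fun x =>
      (f (chart_inv c x) *: eta c (chart_inv c x)) 0 b) (chart c p) =
    pd a (f \o chart_inv c) (chart c p) * eta c p 0 b +
    f p * pd a (fun x => eta c (chart_inv c x) 0 b) (chart c p).
  have := pdM a (smooth_fun_differentiable sf cp)
    (one_form_differentiable b oe cp).
  rewrite /= chartK// => <-.
  by apply: near_eq_pd; apply: near_chart_img => // x _; rewrite mxE.
by rewrite !E; ring.
Qed.

Lemma dform_sum (I : Type) (r : seq I) (eta : I -> local1 A) c p :
  (forall i, one_form (eta i)) -> chart_dom c p ->
  dform ((fun c p => \sum_(i <- r) eta i c p) : local1 A) c p =
  \sum_(i <- r) dform (eta i) c p.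
Proof.
move=> oe cp; elim: r => [|i r IH].
  rewrite big_nil; apply/matrixP => k l; rewrite !mxE.
  have E (a b : 'I_n) : pd a (fun x => (\sum_(i <- [::])
      eta i c (chart_inv c x)) 0 b) (chart c p) = 0.
    rewrite -(pd_cst a (0 : F) (chart c p)).
    by apply: near_eq_pd; apply: near_chart_img => // x _; rewrite big_nil mxE.
  by rewrite !E subrr.
rewrite big_cons -IH -dformD//; last exact: one_form_sum.
by congr (dform _ c p); apply/funext => c'; apply/funext => q; rewrite big_cons.
Qed.

Lemma dform_dfun f c p : smooth_fun A f -> chart_dom c p ->
  dform (dfun f) c p = 0.
Proof.
move=> sf cp; apply/matrixP => k l; rewrite !mxE.
have E (a b : 'I_n) : pd a (fun x => dfun f c (chart_inv c x) 0 b) (chart c p) =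
    pd a (pd b (f \o chart_inv c)) (chart c p).
  apply: near_eq_pd; apply: near_chart_img => // x /chart_invK[_ cx].
  by rewrite mxE cx.
have oc := open_chart_img (c := c).
by rewrite !E (schwarz k l oc (chart_img_mem cp) (sf c 2%N)) subrr.
Qed.

End FormCalculus.

Section Frames.
Variables (F : realType) (n : nat) (M : topologicalType).
Variable A : smooth_atlas F n M.
Variable alpha : 'I_n -> local1 A.
Hypothesis coframe_alpha : coframing alpha.
Implicit Types (c : chart_index A) (f : M -> F) (p : M).

Definition coframe_mx c p : 'M[F]_n := \matrix_i alpha i c p.

Lemma coframe_mx_unit c p : chart_dom c p -> coframe_mx c p \in unitmx.
Proof.
by move=> cp; rewrite -row_free_unit; have [_] := coframe_alpha; apply.
Qed.

Lemma coframe_sum c p (v : 'rV[F]_n) :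
  \sum_k v 0 k *: alpha k c p = v *m coframe_mx c p.
Proof. by rewrite mulmx_sum_row; apply: eq_bigr => k _; rewrite rowK. Qed.

(** The components of df in a coframing do not depend on the chart, since df
    and the coframing are both multiplied by the same Jacobian matrix. *)
Lemma frame_derivP f c p : smooth_fun A f -> chart_dom c p ->
  dfun f c p = \sum_k frame_deriv alpha f p 0 k *: alpha k c p.
Proof.
move=> sf cp; rewrite /frame_deriv.
set S := [set v : 'rV[F]_n | _].
suff : S (xget 0 S) by apply.
pose v := dfun f c p *m invmx (coframe_mx c p).
apply: (@xgetI _ _ S v) => c' c'p; rewrite coframe_sum.
have -> : coframe_mx c' p = coframe_mx c p *m jac c' c p.
  apply/row_matrixP => i; rewrite row_mul !rowK.
  by have [oa _] := coframe_alpha; have [_ ta] := oa i; exact: ta.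
rewrite mulmxA mulmxKV; last exact: coframe_mx_unit.
exact: dfun_transition.
Qed.

Lemma frame_derivE f c p : smooth_fun A f -> chart_dom c p ->
  frame_deriv alpha f p = dfun f c p *m invmx (coframe_mx c p).
Proof.
move=> sf cp; rewrite (frame_derivP sf cp) coframe_sum mulmxK//.
exact: coframe_mx_unit.
Qed.

(** In a chart, these components are obtained from the partial derivatives of f
    by the inverse matrix of the coframing; Cramer's formula makes it smooth. *)
Lemma smooth_frame_deriv f k : smooth_fun A f ->
  smooth_fun A (fun p => frame_deriv alpha f p 0 k).
Proof.
move=> sf c; have oc := open_chart_img (c := c).
apply: (smooth_on_ext oc (f := fun x => \sum_l dfun f c (chart_inv c x) 0 l *
    invmx (coframe_mx c (chart_inv c x)) l k)).
  by move=> x /chart_invK[cx _]; rewrite /= (frame_derivE sf cx) mxE.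
apply: smooth_on_sum => // l; apply: smooth_onM => //.
  by have [sd _] := one_form_dfun sf; exact: sd.
apply: smooth_on_invmx => // [x /chart_invK[cx _]|i j].
  exact: coframe_mx_unit.
have [oa _] := coframe_alpha; have [sa _] := oa i.
by apply: smooth_on_ext (sa c j) => // x _; rewrite mxE.
Qed.

End Frames.

(** * Product with a coordinate space *)

Section ProductForms.
Variables (F : realType) (n m : nat) (M : topologicalType).
Variable A : smooth_atlas F n M.
Local Notation E := (M * 'rV[F]_m)%type.
Local Notation AE := (prod_atlas m A).
Implicit Types (f : M -> F) (eta : local1 A) (c : chart_index A) (z : E).

Lemma prod_chart_img (c : chart_index AE) x :
  chart_img c x -> chart_img (c : chart_index A) (lsubmx x).
Proof. by case=> z cz <-; exists z.1; rewrite //= /prod_chart row_mxKl. Qed.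

Lemma pd_lshift (h : 'rV[F]_n -> F) (j : 'I_n) (x : 'rV[F]_(n + m)) :
  pd (lshift m j) (h \o lsubmx) x = pd j h (lsubmx x).
Proof. by rewrite pd_lsubmx (unsplitK (inl j)). Qed.

Lemma pd_rshift (h : 'rV[F]_n -> F) (j : 'I_m) (x : 'rV[F]_(n + m)) :
  pd (rshift n j) (h \o lsubmx) x = 0.
Proof. by rewrite pd_lsubmx (unsplitK (inr j)). Qed.

Lemma pd_coord q (i j : 'I_q) (x : 'rV[F]_q) :
  pd i (fun y => y 0 j) x = (i == j)%:R.
Proof.
rewrite /pd /derive; apply: cvg_lim => //.
apply: cvg_near_cst; near=> h; rewrite /= !mxE addrK scalerA eq_sym.
rewrite mulVf ?scale1r//.
by near: h; exact: nbhs_dnbhs_neq.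
Unshelve. all: by end_near. Qed.

Lemma smooth_fun_fst f :
  smooth_fun A f -> smooth_fun AE (fun z => f z.1).
Proof.
move=> sf c k; have := @Ck_lsubmx F n m k _ _ (sf c k).
by apply: Ck_sub => x /prod_chart_img.
Qed.

Lemma smooth_fun_snd j : smooth_fun AE (fun z => z.2 0 j).
Proof.
move=> c k; rewrite (_ : _ \o _ = fun x : 'rV[F]_(n + m) => x 0 (rshift n j)).
  exact: Ck_coord.
by apply/funext => x; rewrite /= mxE.
Qed.

Lemma dfun_fst f (c : chart_index AE) z :
  dfun (A := AE) (fun z => f z.1) c z = pull_fst (m := m) (dfun f) c z.
Proof.
apply/rowP => l; rewrite mxE.
rewrite (_ : _ \o _ = (f \o chart_inv (c : chart_index A)) \o lsubmx)//.
case: (split_ordP l) => j ->.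
  by rewrite pd_lshift /pull_fst row_mxEl mxE /= /prod_chart row_mxKl.
by rewrite pd_rshift /pull_fst row_mxEr mxE.
Qed.

Lemma dfun_snd j (c : chart_index AE) z :
  dfun (A := AE) (fun z => z.2 0 j) c z = delta_mx 0 (rshift n j).
Proof.
apply/rowP => l; rewrite !mxE eqxx /=.
rewrite (_ : _ \o _ = fun x : 'rV[F]_(n + m) => x 0 (rshift n j)).
  exact: pd_coord.
by apply/funext => x; rewrite /= mxE.
Qed.

Lemma one_form_pull_fst eta : one_form eta -> one_form (pull_fst (m := m) eta).
Proof.
move=> [se te]; split=> [c j k|c c' z cz c'z].
  case: (split_ordP j) => i ->.
    apply: (@Ck_ext _ _ _ _
      ((fun x => eta c (chart_inv (c : chart_index A) x) 0 i) \o lsubmx)).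
    - exact: open_chart_img.
    - by move=> x _; rewrite /pull_fst row_mxEl.
    - by apply: Ck_sub (@Ck_lsubmx F n m k _ _ (se c i k)) => x /prod_chart_img.
  apply: (@Ck_ext _ _ _ _ (fun=> 0)); last exact: Ck_cst.
    exact: open_chart_img.
  by move=> x _; rewrite /pull_fst row_mxEr mxE.
apply/rowP => l; rewrite [RHS]mxE big_split_ord /=.
rewrite [X in _ + X]big1 ?addr0 => [|i _]; last first.
  by rewrite /pull_fst row_mxEr mxE mul0r.
under eq_bigr => i _ do rewrite /pull_fst row_mxEl mxE.
have trl (i : 'I_n) : (fun x => @chart _ _ _ AE c' (@chart_inv _ _ _ AE c x) 0
      (lshift m i)) =
    (fun x => @chart _ _ _ A c' (@chart_inv _ _ _ A c x) 0 i) \o lsubmx.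
  by apply/funext => x; rewrite /= /prod_chart row_mxEl.
case: (split_ordP l) => j ->.
  rewrite /pull_fst row_mxEl (te c c')// mxE; apply: eq_bigr => i _.
  by rewrite trl pd_lshift mxE /= /prod_chart row_mxKl.
rewrite /pull_fst row_mxEr mxE big1// => i _.
by rewrite trl pd_rshift mulr0.
Qed.

Lemma dform_pull_fst eta (c : chart_index AE) z : one_form eta ->
  chart_dom c z ->
  dform (pull_fst (m := m) eta) c z =
  block_mx (dform eta (c : chart_index A) z.1) 0 0 0.
Proof.
move=> [se _] cz; pose e i x := eta c (chart_inv (c : chart_index A) x) 0 i.
have El (i : 'I_n) : (fun x => pull_fst (m := m) eta c
    (@chart_inv _ _ _ AE c x) 0 (lshift m i)) = e i \o lsubmx.
  by apply/funext => x; rewrite /= /pull_fst row_mxEl.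
have Er (i : 'I_m) : (fun x => pull_fst (m := m) eta c
    (@chart_inv _ _ _ AE c x) 0 (rshift n i)) = fun=> 0.
  by apply/funext => x; rewrite /= /pull_fst row_mxEr mxE.
apply/matrixP => k l; rewrite mxE.
case: (split_ordP k) => k' ->; case: (split_ordP l) => l' ->.
- rewrite block_mxEul !El !pd_lshift mxE /=.
  by rewrite /prod_chart row_mxKl.
- by rewrite block_mxEur El Er pd_rshift pd_cst subrr mxE.
- by rewrite block_mxEdl El Er pd_rshift pd_cst subrr mxE.
- by rewrite block_mxEdr !Er !pd_cst subrr mxE.
Qed.

Lemma wedge_row_mx0 (u v : 'rV[F]_n) :
  wedge (row_mx u 0 : 'rV[F]_(n + m)) (row_mx v 0) =
  block_mx (wedge u v) 0 0 0.
Proof.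
apply/matrixP => k l; rewrite mxE.
case: (split_ordP k) => k' ->; case: (split_ordP l) => l' ->.
- by rewrite block_mxEul !row_mxEl mxE.
- by rewrite block_mxEur !row_mxEl !row_mxEr !mxE mulr0 mul0r subrr.
- by rewrite block_mxEdl !row_mxEl !row_mxEr !mxE mulr0 mul0r subrr.
- by rewrite block_mxEdr !row_mxEr !mxE mulr0 subrr.
Qed.

End ProductForms.

(* [ring], after abstraction of the partial derivatives and matrix entries,
   which it would otherwise compare up to conversion. *)
Local Ltac ring_atoms :=
  repeat match goal with
  | |- context [Adot ?R ?I ?J ?K ?al ?i ?j ?k ?z] =>
      move: (Adot R I J K al i j k z) => ?
  | |- context [fder ?al ?f ?k ?z] => move: (fder al f k z) => ?
  | |- context [Amin ?i ?j ?z] => move: (Amin i j z) => ?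
  | |- context [minor ?a ?i ?j] => move: (minor a i j) => ?
  | |- context [pd ?l ?f ?x] => move: (pd l f x) => ?
  | |- context [fun_of_matrix ?X ?i ?j] => move: (X i j) => ?
  end; ring.

Lemma sum3 (V : nmodType) (f : 'I_3 -> V) : \sum_i f i = f i1 + f i2 + f i3.
Proof.
rewrite !big_ord_recl big_ord0 addr0 addrA.
by congr (f _ + f _ + f _); exact: val_inj.
Qed.

(** * The Bianchi identity of a Cartan structure *)

Section Bianchi.
Variables (F : realType) (M : topologicalType) (A : smooth_atlas F 3 M).
Implicit Types (c : chart_index A) (f : M -> F) (eta zeta : local1 A) (p : M).

(** The coefficient of dX on the coordinate volume form, for a 2-form X. *)
Definition d2form (X : local2 A) c p : F :=
  pd i3 (fun x => X c (chart_inv c x) i1 i2) (chart c p)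
  + pd i1 (fun x => X c (chart_inv c x) i2 i3) (chart c p)
  + pd i2 (fun x => X c (chart_inv c x) i3 i1) (chart c p).

(** The coefficient of X /\ w on the volume form. *)
Definition vol (X : 'M[F]_3) (w : 'rV[F]_3) : F :=
  X i1 i2 * w 0 i3 + X i2 i3 * w 0 i1 + X i3 i1 * w 0 i2.

Lemma d2form_ext (X Y : local2 A) c p : chart_dom c p ->
  (forall q, chart_dom c q -> X c q = Y c q) -> d2form X c p = d2form Y c p.
Proof.
move=> cp XY; rewrite /d2form; congr (_ + _ + _);
  by apply: near_eq_pd; apply: near_chart_img => // x /chart_invK[cx _];
  rewrite XY.
Qed.

(** d(d eta) = 0: the second derivatives cancel in pairs by [schwarz]. *)
Lemma d2form_dform eta c p : one_form eta -> chart_dom c p ->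
  d2form (dform eta) c p = 0.
Proof.
move=> [se te] cp; pose e j x := eta c (chart_inv c x) 0 j.
have E (a k l : 'I_3) :
    pd a (fun x => dform eta c (chart_inv c x) k l) (chart c p) =
    pd a (pd k (e l)) (chart c p) - pd a (pd l (e k)) (chart c p).
  rewrite -pdB.
  - apply: near_eq_pd; apply: near_chart_img => // x /chart_invK[_ cx].
    by rewrite mxE cx.
  - apply: (smooth_differentiable (smooth_pd k (se c l))).
    exact: chart_img_mem.
  - apply: (smooth_differentiable (smooth_pd l (se c k))).
    exact: chart_img_mem.
have S a b j : pd a (pd b (e j)) (chart c p) = pd b (pd a (e j)) (chart c p).
  have oc := open_chart_img (c := c).
  exact: (schwarz _ _ oc (chart_img_mem cp) (se c j 2%N)).
rewrite /d2form !E (S i3 i1) (S i2 i1) (S i3 i2).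
ring_atoms.
Qed.

Lemma d2form_Zwedge f eta zeta c p : smooth_fun A f -> one_form eta ->
  one_form zeta -> chart_dom c p ->
  d2form (fun c q => f q *: wedge (eta c q) (zeta c q)) c p =
  vol (wedge (eta c p) (zeta c p)) (dfun f c p)
  + f p * (vol (dform eta c p) (zeta c p) - vol (dform zeta c p) (eta c p)).
Proof.
move=> sf oe oz cp; pose u j x := eta c (chart_inv c x) 0 j.
pose v j x := zeta c (chart_inv c x) 0 j; pose h := f \o chart_inv c.
have du j : differentiable (u j) (chart c p) by exact: one_form_differentiable.
have dv j : differentiable (v j) (chart c p) by exact: one_form_differentiable.
have dh : differentiable h (chart c p) by exact: smooth_fun_differentiable.
have E (a k l : 'I_3) :
    pd a (fun x => (f (chart_inv c x) *:
      wedge (eta c (chart_inv c x)) (zeta c (chart_inv c x))) k l) (chart c p) =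
    pd a h (chart c p) *
      (eta c p 0 k * zeta c p 0 l - eta c p 0 l * zeta c p 0 k)
    + f p * (pd a (u k) (chart c p) * zeta c p 0 l
             + eta c p 0 k * pd a (v l) (chart c p)
             - (pd a (u l) (chart c p) * zeta c p 0 k
                + eta c p 0 l * pd a (v k) (chart c p))).
  rewrite (_ : (fun x => _) = fun x => h x * (u k x * v l x - u l x * v k x));
    last by apply/funext => x; rewrite !mxE.
  rewrite pdM//; last by apply: differentiableB; apply: differentiableM.
  rewrite pdB; [|exact: differentiableM..].
  by rewrite !pdM// /u /v /h /= !chartK.
rewrite /d2form !E /vol /wedge /dform !mxE -/h.
rewrite -!/(u _) -!/(v _) {du dv dh E}.
ring_atoms.
Qed.


(** Both sides expand to the same polynomial in nine entries; these are read off
    through natural numbers, so that the lifted ordinals of the expansion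
    compute. *)
Lemma volE (u v w : 'rV[F]_3) :
  vol (wedge u v) w = \det (\matrix_(i < 3) [:: u; v; w]`_i).
Proof.
set X := \matrix_i _; pose g i j := X (inord i) (inord j).
have Xg i j : X i j = g (val i) (val j) by rewrite /g !inord_val.
have uX j : u 0 j = X i1 j by rewrite mxE.
have vX j : v 0 j = X i2 j by rewrite mxE.
have wX j : w 0 j = X i3 j by rewrite mxE.
rewrite /vol !mxE !uX !vX !wX; move: Xg; move: X g {uX vX wX} => X g Xg.
rewrite (expand_det_row _ i1) !big_ord_recl big_ord0 /cofactor.
rewrite !(expand_det_row _ (@Ordinal 2 0 isT)) !big_ord_recl !big_ord0.
by rewrite /cofactor !det_mx11 !mxE !Xg /= /bump /=; ring.
Qed.

Variables (R : M -> F) (alpha : 'I_3 -> local1 A).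
Hypotheses (sR : smooth_fun A R) (coframe_alpha : coframing alpha).
Hypothesis structure_alpha : forall c p, chart_dom c p ->
    [/\ dform (alpha i1) c p = wedge (alpha i2 c p) (alpha i3 c p),
        dform (alpha i2) c p = - wedge (alpha i1 c p) (alpha i3 c p) &
        dform (alpha i3) c p = R p *: wedge (alpha i1 c p) (alpha i2 c p)].

(** The exterior derivative of d alpha^3 = R alpha^1 /\ alpha^2 is
    dR /\ alpha^1 /\ alpha^2, because d alpha^1 /\ alpha^2 and
    alpha^1 /\ d alpha^2 vanish; and dR /\ alpha^1 /\ alpha^2 is R_3 times a
    volume form. *)
Lemma bianchi p : frame_deriv alpha R p 0 i3 = 0.
Proof.
have [c cp] := chart_cover A p; have [oa ua] := coframe_alpha.
have [S1 S2 _] := structure_alpha cp.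
have := d2form_dform (oa i3) cp.
pose Y (c : chart_index A) q := R q *: wedge (alpha i1 c q) (alpha i2 c q).
rewrite (d2form_ext (Y := Y) cp); last first.
  by move=> q cq; case: (structure_alpha cq).
rewrite d2form_Zwedge// (frame_derivP coframe_alpha sR cp) S1 S2.
move: (frame_deriv alpha R p) => r.
have -> : vol (wedge (alpha i1 c p) (alpha i2 c p))
      (\sum_k r 0 k *: alpha k c p) =
    r 0 i3 * \det (coframe_mx alpha c p).
  have -> : coframe_mx alpha c p =
      \matrix_(i < 3) [:: alpha i1 c p; alpha i2 c p; alpha i3 c p]`_i.
    apply/row_matrixP => i; rewrite !rowK.
    by case: i => [[|[|[|//]]] hi] /=; congr (alpha _ c p); exact: val_inj.
  by rewrite -volE sum3 /vol !mxE; ring_atoms.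
have -> : vol (wedge (alpha i2 c p) (alpha i3 c p)) (alpha i2 c p) = 0.
  by rewrite /vol !mxE; ring_atoms.
have -> : vol (- wedge (alpha i1 c p) (alpha i3 c p)) (alpha i1 c p) = 0.
  by rewrite /vol !mxE; ring_atoms.
rewrite subrr mulr0 addr0 => /eqP; rewrite mulf_eq0 => /orP[/eqP//|].
have := coframe_mx_unit coframe_alpha cp.
by rewrite unitmxE unitfE => /negbTE ->.
Qed.

End Bianchi.

(** * Total derivatives on the Pfaffian system *)

Section TotalDerivatives.
Variables (F : realType) (Sigma : manifold F 3) (R I J K : Sigma -> F).
Variable alpha : 'I_3 -> local1 (matlas Sigma).
Hypotheses (sR : smooth_fun (matlas Sigma) R) (sI : smooth_fun (matlas Sigma) I)
  (sJ : smooth_fun (matlas Sigma) J) (sK : smooth_fun (matlas Sigma) K).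
Hypothesis coframe_alpha : coframing alpha.

Local Notation AT := (atlasT Sigma).
Local Notation ET := (SigmaT Sigma).
Local Notation alphaT := (alphaT alpha).
Local Notation theta := (theta R I J K alpha).
Local Notation ajet := (ajet R I J K).
Implicit Types (c : chart_index AT) (z : ET) (G H : ET -> F).

Definition aidx (i j : 'I_3) : 'I_(3 * 3 + 3 * 6) := lshift _ (mxvec_index i j).
Definition qidx (i : 'I_3) (m : 'I_6) : 'I_(3 * 3 + 3 * 6) :=
  rshift _ (mxvec_index i m).

Lemma acoordE i j : (fun z => acoord z i j) = (fun z => z.2 0 (aidx i j)).
Proof. by apply/funext => z; rewrite /acoord !mxE. Qed.

Lemma qcoordE i m : (fun z => qcoord z i m) = (fun z => z.2 0 (qidx i m)).
Proof. by apply/funext => z; rewrite /qcoord !mxE. Qed.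

Lemma one_form_alphaT k : one_form (alphaT k).
Proof.
by apply: one_form_pull_fst; have [oa _] := coframe_alpha; exact: oa.
Qed.

Lemma smooth_base f : smooth_fun (matlas Sigma) f ->
  smooth_fun AT (fun z => f z.1).
Proof. exact: smooth_fun_fst. Qed.

Lemma smooth_acoord i j : smooth_fun AT (fun z => acoord z i j).
Proof. by rewrite acoordE; exact: smooth_fun_snd. Qed.

Lemma smooth_qcoord i m : smooth_fun AT (fun z => qcoord z i m).
Proof. by rewrite qcoordE; exact: smooth_fun_snd. Qed.

Lemma dfun_acoord i j c z :
  dfun (fun z => acoord z i j) c z = delta_mx 0 (rshift 3 (aidx i j)).
Proof. by rewrite acoordE; exact: dfun_snd. Qed.

Lemma dfun_qcoord i m c z :
  dfun (fun z => qcoord z i m) c z = delta_mx 0 (rshift 3 (qidx i m)).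
Proof. by rewrite qcoordE; exact: dfun_snd. Qed.

Lemma smooth_Amin i j : smooth_fun AT (Amin i j).
Proof.
move=> c; apply: (smooth_on_det (open_chart_img (c := c))) => k l.
have sa := smooth_acoord (lift i k) (lift j l) c.
apply: (smooth_on_ext (open_chart_img (c := c))) sa => x _.
by rewrite [RHS]mxE [RHS]mxE.
Qed.

(** When omega = A alpha, the structure equations of omega read
    d omega^i = - (N_i1 alpha^2 /\ alpha^3 + N_i2 alpha^1 /\ alpha^3
    + N_i3 alpha^1 /\ alpha^2), with N_il = [finsler_coef i l]. *)
Definition finsler_coef (i l : 'I_3) z : F := match val i with
  | 0 => I z.1 * Amin i2 l z - Amin i1 l z
  | 1 => Amin i2 l z
  | _ => J z.1 * Amin i2 l z - K z.1 * Amin i3 l z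
  end.

Definition B12T i z := B12 (R z.1) (I z.1) (J z.1) (K z.1) (acoord z) i.
Definition B23T i z := B23 (I z.1) (J z.1) (K z.1) (acoord z) i.
Definition B31T i z := B31 (I z.1) (J z.1) (K z.1) (acoord z) i.

Lemma B12TE i z : B12T i z = acoord z i i3 * R z.1 + finsler_coef i i3 z.
Proof.
by case: i => [[|[|[|//]]] hi]; rewrite /B12T /B12 /finsler_coef /Amin /=
  (bool_irrelevance hi isT); ring_atoms.
Qed.

Lemma B23TE i z : B23T i z = acoord z i i1 + finsler_coef i i1 z.
Proof.
by case: i => [[|[|[|//]]] hi]; rewrite /B23T /B23 /finsler_coef /Amin /=
  (bool_irrelevance hi isT); ring_atoms.
Qed.

Lemma B31TE i z : B31T i z = acoord z i i2 - finsler_coef i i2 z.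
Proof.
by case: i => [[|[|[|//]]] hi]; rewrite /B31T /B31 /finsler_coef /Amin /=
  (bool_irrelevance hi isT); ring_atoms.
Qed.

Lemma smooth_finsler_coef i l : smooth_fun AT (finsler_coef i l).
Proof.
have sIT := smooth_base sI; have sJT := smooth_base sJ.
have sKT := smooth_base sK.
case: i => [[|[|[|//]]] hi]; rewrite /finsler_coef /=.
- apply: smooth_funD; first by apply: smooth_funM => //; exact: smooth_Amin.
  by apply: smooth_funN; exact: smooth_Amin.
- exact: smooth_Amin.
- apply: smooth_funD; first by apply: smooth_funM => //; exact: smooth_Amin.
  by apply: smooth_funN; apply: smooth_funM => //; exact: smooth_Amin.
Qed.

Lemma smooth_B12T i : smooth_fun AT (B12T i).
Proof.
rewrite (_ : B12T i = fun z => acoord z i i3 * R z.1 + finsler_coef i i3 z).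
  apply: smooth_funD; last exact: smooth_finsler_coef.
  by apply: smooth_funM; [exact: smooth_acoord|exact: smooth_base].
by apply/funext => z; exact: B12TE.
Qed.

Lemma smooth_B23T i : smooth_fun AT (B23T i).
Proof.
rewrite (_ : B23T i = fun z => acoord z i i1 + finsler_coef i i1 z).
  by apply: smooth_funD; [exact: smooth_acoord|exact: smooth_finsler_coef].
by apply/funext => z; exact: B23TE.
Qed.

Lemma smooth_B31T i : smooth_fun AT (B31T i).
Proof.
rewrite (_ : B31T i = fun z => acoord z i i2 - finsler_coef i i2 z).
  apply: smooth_funD; first exact: smooth_acoord.
  by apply: smooth_funN; exact: smooth_finsler_coef.
by apply/funext => z; exact: B31TE.
Qed.

Lemma smooth_ajet i j k : smooth_fun AT (ajet i j k).
Proof.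
case: j => [[|[|[|//]]] hj]; case: k => [[|[|[|//]]] hk]; rewrite /ajet /jet /=;
  try exact: smooth_qcoord.
- by apply: smooth_funD; [exact: smooth_qcoord|exact: smooth_B12T].
- by apply: smooth_funD; [exact: smooth_qcoord|exact: smooth_B23T].
- by apply: smooth_funD; [exact: smooth_qcoord|exact: smooth_B31T].
Qed.

(** The tangent vectors dual to the alpha^k that annihilate the theta_ij; the
    latter prescribes the components along the a_ij, and those along the
    a_ij.k may be chosen to be 0. *)
Definition jet_frame c z (k : 'I_3) : 'cV[F]_(3 + (3 * 3 + 3 * 6)) :=
  col_mx (col k (invmx (coframe_mx alpha (c : chart_index (matlas Sigma)) z.1)))
    (col_mx (mxvec (\matrix_(i, j) ajet i j k z))^T 0).

Lemma alphaT_jet_frame c z j k : chart_dom c z ->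
  alphaT j c z *m jet_frame c z k = (j == k)%:R%:M.
Proof.
move=> cz; rewrite mul_row_col mul0mx addr0 colE mulmxA.
have -> : alpha j c z.1 =
    row j (coframe_mx alpha (c : chart_index (matlas Sigma)) z.1).
  by rewrite rowK.
rewrite -row_mul mulmxV; last by exact: coframe_mx_unit.
by rewrite -colE; apply/rowP => l; rewrite ord1 !mxE.
Qed.

Lemma theta_jet_frame c z i j k : chart_dom c z ->
  theta i j c z *m jet_frame c z k = 0.
Proof.
move=> cz; rewrite /theta mulmxBl dfun_acoord mulmx_suml.
rewrite (bigD1 k)//= -scalemxAl alphaT_jet_frame// eqxx.
rewrite big1 => [|l lk]; last first.
  by rewrite -scalemxAl alphaT_jet_frame// (negbTE lk) raddf0 scaler0.
rewrite -rowE scale_scalar_mx mulr1 addr0.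
suff -> : row (rshift 3 (aidx i j)) (jet_frame c z k) = (ajet i j k z)%:M.
  exact: subrr.
apply/rowP => l; rewrite ord1 [LHS]mxE /jet_frame /aidx col_mxEd col_mxEu.
by rewrite [LHS]mxE mxvecE !mxE.
Qed.

(** The g_k are the formal derivatives G_{.k}, up to uniqueness
    ([formal_derivE]).  Smoothness is included because the Leibniz rule of
    [total_derivM] uses it. *)
Definition total_deriv G (g : 'I_3 -> ET -> F) : Prop :=
  [/\ smooth_fun AT G, forall k, smooth_fun AT (g k) &
   forall c z, chart_dom c z -> exists h : 'M[F]_3,
     dfun G c z = \sum_k g k z *: alphaT k c z
       + \sum_i \sum_j h i j *: theta i j c z].

Lemma theta_sum0 c z : \sum_i \sum_j (0 : 'M[F]_3) i j *: theta i j c z = 0.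
Proof.
by rewrite big1// => i _; rewrite big1// => j _; rewrite mxE scale0r.
Qed.

Lemma total_deriv_base f : smooth_fun (matlas Sigma) f ->
  total_deriv (fun z => f z.1) (fun k z => fder alpha f k z).
Proof.
move=> sf; split; first exact: smooth_base.
  move=> k; have := smooth_frame_deriv coframe_alpha k sf.
  exact: smooth_base.
move=> c z cz; exists 0; rewrite theta_sum0 addr0 dfun_fst /pull_fst.
rewrite (frame_derivP coframe_alpha sf cz).
apply/rowP => l; rewrite summxE.
case: (split_ordP l) => l' ->.
  rewrite row_mxEl summxE; apply: eq_bigr => k _.
  by rewrite [LHS]mxE [RHS]mxE row_mxEl.
rewrite row_mxEr mxE big1// => k _.
by rewrite mxE row_mxEr mxE mulr0.
Qed.

Lemma total_deriv_acoord i j :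
  total_deriv (fun z => acoord z i j) (ajet i j).
Proof.
split; [exact: smooth_acoord|by move=> k; exact: smooth_ajet|].
move=> c z cz; exists (delta_mx i j).
rewrite [X in _ + X](_ : _ = theta i j c z).
  by rewrite /theta addrC subrK.
rewrite (bigD1 i)//= (bigD1 j)//= big1 => [|j' jj]; last first.
  by rewrite mxE (negbTE jj) andbF scale0r.
rewrite big1 => [|i' ii]; last first.
  by rewrite big1// => j' _; rewrite mxE (negbTE ii) scale0r.
by rewrite mxE !eqxx scale1r !addr0.
Qed.

Lemma total_deriv_cst (a : F) : total_deriv (fun=> a) (fun _ _ => 0).
Proof.
split; [exact: smooth_fun_cst|by move=> k; exact: smooth_fun_cst|].
move=> c z cz; exists 0; rewrite theta_sum0 addr0 dfun_cst big1// => k _.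
by rewrite scale0r.
Qed.

Lemma total_derivD G H g h : total_deriv G g -> total_deriv H h ->
  total_deriv (fun z => G z + H z) (fun k z => g k z + h k z).
Proof.
move=> [sG sg tG] [sH sh tH]; split; first exact: smooth_funD.
  by move=> k; exact: smooth_funD.
move=> c z cz; have [x Ex] := tG c z cz; have [y Ey] := tH c z cz.
exists (x + y); rewrite dfunD// Ex Ey addrACA.
congr (_ + _); rewrite -big_split.
  by apply: eq_bigr => k _; rewrite scalerDl.
apply: eq_bigr => i _; rewrite -big_split; apply: eq_bigr => j _.
by rewrite mxE scalerDl.
Qed.

Lemma total_derivM G H g h : total_deriv G g -> total_deriv H h ->
  total_deriv (fun z => G z * H z) (fun k z => g k z * H z + G z * h k z).
Proof.
move=> [sG sg tG] [sH sh tH]; split; first exact: smooth_funM.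
  by move=> k; apply: smooth_funD; exact: smooth_funM.
move=> c z cz; have [x Ex] := tG c z cz; have [y Ey] := tH c z cz.
exists (H z *: x + G z *: y); rewrite dfunM// Ex Ey !scalerDr addrACA.
rewrite !scaler_sumr; congr (_ + _); rewrite -big_split.
  by apply: eq_bigr => k _; rewrite scalerDl !scalerA [H z * _]mulrC.
apply: eq_bigr => i _; rewrite !scaler_sumr -big_split; apply: eq_bigr => j _.
by rewrite !mxE scalerDl !scalerA.
Qed.

Lemma total_derivN G g : total_deriv G g ->
  total_deriv (fun z => - G z) (fun k z => - g k z).
Proof.
move=> tG; have := total_derivM (total_deriv_cst (-1)) tG.
rewrite (_ : (fun z => -1 * G z) = fun z => - G z); last first.
  by apply/funext => z; rewrite mulN1r.
rewrite (_ : (fun k z => _ + _) = fun k z => - g k z)//.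
by apply/funext => k; apply/funext => z; rewrite mul0r add0r mulN1r.
Qed.

(** Evaluation on [jet_frame] kills the theta_ij and reads off the coefficient
    of each alpha^k. *)
Lemma total_deriv_unique G g c z (v : 'rV[F]_3) (h : 'M[F]_3) :
  total_deriv G g -> chart_dom c z ->
  dfun G c z = \sum_k v 0 k *: alphaT k c z
    + \sum_i \sum_j h i j *: theta i j c z ->
  v = \row_k g k z.
Proof.
move=> [_ _ tG] cz Ev; have [h' Eg] := tG c z cz.
have ev (w : 'I_3 -> F) (x : 'M[F]_3) k :
    (\sum_k w k *: alphaT k c z + \sum_i \sum_j x i j *: theta i j c z)
      *m jet_frame c z k = (w k)%:M.
  rewrite mulmxDl !mulmx_suml (bigD1 k)//= -scalemxAl alphaT_jet_frame// eqxx.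
  rewrite [X in _ + X + _]big1 => [|l lk]; last first.
    by rewrite -scalemxAl alphaT_jet_frame// (negbTE lk) raddf0 scaler0.
  rewrite [X in _ + X]big1 => [|i _]; last first.
    rewrite mulmx_suml big1// => j _.
    by rewrite -scalemxAl theta_jet_frame// scaler0.
  by rewrite !addr0 scale_scalar_mx mulr1.
apply/rowP => k; rewrite mxE.
have := ev (fun k => v 0 k) h k; rewrite -Ev Eg (ev (fun k => g k z)) => E.
by have := congr1 (fun X : 'M[F]_1 => X 0 0) E; rewrite !mxE eqxx !mulr1n.
Qed.

Lemma formal_derivE G g z : total_deriv G g ->
  formal_deriv R I J K alpha G z = \row_k g k z.
Proof.
move=> tG; have [c cz] := chart_cover AT z; rewrite /formal_deriv.
set S := [set v : 'rV[F]_3 | _].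
have Sg : S (\row_k g k z).
  move=> c' c'z; have [_ _ /(_ c' z c'z)[h Eh]] := tG; exists h.
  by rewrite Eh; congr (_ + _); apply: eq_bigr => k _; rewrite mxE.
have /(_ c cz)[h Eh] := @xgetI _ 0 S _ Sg.
exact: total_deriv_unique tG cz Eh.
Qed.

Lemma total_deriv_sum (T : Type) (r : seq T) (G : T -> ET -> F) :
  (forall t, exists g, total_deriv (G t) g) ->
  exists g, total_deriv (fun z => \sum_(t <- r) G t z) g.
Proof.
move=> tG; elim: r => [|t r [g IH]].
  exists (fun _ _ => 0); rewrite (_ : (fun z => _) = fun=> 0).
    exact: total_deriv_cst.
  by apply/funext => z; rewrite big_nil.
have [h th] := tG t; eexists.
rewrite (_ : (fun z => _) = fun z => G t z + \sum_(t <- r) G t z).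
  exact: total_derivD th IH.
by apply/funext => z; rewrite big_cons.
Qed.

Lemma total_deriv_prod (T : Type) (r : seq T) (G : T -> ET -> F) :
  (forall t, exists g, total_deriv (G t) g) ->
  exists g, total_deriv (fun z => \prod_(t <- r) G t z) g.
Proof.
move=> tG; elim: r => [|t r [g IH]].
  exists (fun _ _ => 0); rewrite (_ : (fun z => _) = fun=> 1).
    exact: total_deriv_cst.
  by apply/funext => z; rewrite big_nil.
have [h th] := tG t; eexists.
rewrite (_ : (fun z => _) = fun z => G t z * \prod_(t <- r) G t z).
  exact: total_derivM th IH.
by apply/funext => z; rewrite big_cons.
Qed.

(** A minor is a polynomial in the a_ij, and these have the a_ij.k as formal
    derivatives. *)
Lemma total_deriv_Amin i j :
  total_deriv (Amin i j) (fun k z => Adot R I J K alpha i j k z).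
Proof.
suff [g tg] : exists g, total_deriv (Amin i j) g.
  rewrite (_ : (fun k z => _) = g)//.
  apply/funext => k; apply/funext => z.
  by rewrite /Adot (formal_derivE _ tg) mxE.
apply: total_deriv_sum => s.
have [g tg] : exists g, total_deriv
    (fun z => \prod_k row' i (col' j (acoord z)) k (perm.fun_of_perm s k)) g.
  apply: total_deriv_prod => k; set l := lift j (perm.fun_of_perm s k).
  exists (ajet (lift i k) l).
  rewrite (_ : (fun z => _) = fun z => acoord z (lift i k) l).
    exact: total_deriv_acoord.
  by apply/funext => z; rewrite [LHS]mxE [LHS]mxE.
by eexists; exact: total_derivM (total_deriv_cst _) tg.
Qed.

Definition finsler_coef_dot (i l k : 'I_3) z : F :=
  let A' m := Adot R I J K alpha m l k z in match val i with
  | 0 => fder alpha I k z * Amin i2 l z + I z.1 * A' i2 - A' i1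
  | 1 => A' i2
  | _ => fder alpha J k z * Amin i2 l z + J z.1 * A' i2
         - (fder alpha K k z * Amin i3 l z + K z.1 * A' i3)
  end.

Lemma total_deriv_finsler_coef i l :
  total_deriv (finsler_coef i l) (finsler_coef_dot i l).
Proof.
have tI := total_deriv_base sI; have tJ := total_deriv_base sJ.
have tK := total_deriv_base sK; have tA m := total_deriv_Amin m l.
case: i => [[|[|[|//]]] hi].
- exact: total_derivD (total_derivM tI (tA i2)) (total_derivN (tA i1)).
- exact: tA.
- exact: total_derivD (total_derivM tJ (tA i2))
    (total_derivN (total_derivM tK (tA i3))).
Qed.

Definition B12_dot (i k : 'I_3) z :=
  ajet i i3 k z * R z.1 + acoord z i i3 * fder alpha R k z
  + finsler_coef_dot i i3 k z.
Definition B23_dot (i k : 'I_3) z := ajet i i1 k z + finsler_coef_dot i i1 k z.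
Definition B31_dot (i k : 'I_3) z := ajet i i2 k z - finsler_coef_dot i i2 k z.

Lemma total_deriv_B12T i : total_deriv (B12T i) (B12_dot i).
Proof.
rewrite (_ : B12T i = fun z => acoord z i i3 * R z.1 + finsler_coef i i3 z).
  apply: total_derivD; last exact: total_deriv_finsler_coef.
  exact: total_derivM (total_deriv_acoord _ _) (total_deriv_base sR).
by apply/funext => z; exact: B12TE.
Qed.

Lemma total_deriv_B23T i : total_deriv (B23T i) (B23_dot i).
Proof.
rewrite (_ : B23T i = fun z => acoord z i i1 + finsler_coef i i1 z).
  exact: total_derivD (total_deriv_acoord _ _) (total_deriv_finsler_coef _ _).
by apply/funext => z; exact: B23TE.
Qed.

Lemma total_deriv_B31T i : total_deriv (B31T i) (B31_dot i).
Proof.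
rewrite (_ : B31T i = fun z => acoord z i i2 - finsler_coef i i2 z).
  exact: total_derivD (total_deriv_acoord _ _)
    (total_derivN (total_deriv_finsler_coef _ _)).
by apply/funext => z; exact: B31TE.
Qed.

(** This is the coefficient of - d(d omega^i) on alpha^1 /\ alpha^2 /\ alpha^3,
    because the 2-forms alpha^j /\ alpha^k of a Cartan structure are closed. *)
Lemma torsionE i z : torsion R I J K alpha i z =
  finsler_coef_dot i i3 i3 z + finsler_coef_dot i i1 i1 z
  - finsler_coef_dot i i2 i2 z.
Proof.
by case: i => [[|[|[|//]]] hi]; rewrite /torsion /finsler_coef_dot /=;
  ring_atoms.
Qed.

End TotalDerivatives.

(** * Torsion *)

Section Pairing.
Variables (F : realType) (N : nat).
Implicit Types (X Y : 'M[F]_N) (a b : 'rV[F]_N) (u v : 'cV[F]_N).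

Definition pairing X u v : F := (u^T *m X *m v) 0 0.

Lemma pairingD X Y u v : pairing (X + Y) u v = pairing X u v + pairing Y u v.
Proof. by rewrite /pairing mulmxDr mulmxDl mxE. Qed.

Lemma pairingZ t X u v : pairing (t *: X) u v = t * pairing X u v.
Proof. by rewrite /pairing -scalemxAr -scalemxAl mxE. Qed.

Lemma pairing_sum (T : finType) (X : T -> 'M[F]_N) u v :
  pairing (\sum_t X t) u v = \sum_t pairing (X t) u v.
Proof. by rewrite /pairing mulmx_sumr mulmx_suml summxE. Qed.

Lemma wedgeE a b : wedge a b = a^T *m b - b^T *m a.
Proof.
apply/matrixP => k l; rewrite !mxE !big_ord_recl !big_ord0 !mxE !addr0.
by rewrite [b 0 k * _]mulrC.
Qed.

Lemma pairing_wedge a b u v : pairing (wedge a b) u v =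
  (a *m u) 0 0 * (b *m v) 0 0 - (b *m u) 0 0 * (a *m v) 0 0.
Proof.
have E (x y : 'rV[F]_N) : u^T *m (x^T *m y) *m v = (x *m u)^T *m (y *m v).
  by rewrite trmx_mul !mulmxA.
rewrite /pairing wedgeE mulmxBr mulmxBl !E !mxE !big_ord_recl !big_ord0.
by rewrite !mxE !addr0.
Qed.

Lemma wedgeC a b : wedge a b = - wedge b a.
Proof. by rewrite !wedgeE opprB. Qed.

Lemma wedgeZl t a b : wedge (t *: a) b = t *: wedge a b.
Proof. by apply/matrixP => k l; rewrite !mxE; ring. Qed.

Lemma wedgeNl a b : wedge (- a) b = - wedge a b.
Proof. by rewrite -scaleN1r wedgeZl scaleN1r. Qed.

Lemma wedge_suml (T : finType) (a : T -> 'rV[F]_N) b :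
  wedge (\sum_t a t) b = \sum_t wedge (a t) b.
Proof.
rewrite wedgeE raddf_sum mulmx_suml mulmx_sumr -sumrB.
by apply: eq_bigr => t _; rewrite wedgeE.
Qed.

(** The structure equations of theta_i1, theta_i2, theta_i3 as identities
    between covectors: p, q, s are the differentials of the three free
    coordinates a_ij.k that occur in d theta_ij, and x, y, w are the values of
    a_ij.1, a_ij.2, a_ij.3. The one a_ij.k that depends on the others by (S) has
    the differential of its free coordinate, plus the b_k a_k, plus th in the
    span of the theta's. In [absorb3] the values u and v are already used in
    [absorb1] and [absorb2], so that a multiple of a1 /\ a2 remains. *)
Section Absorption.
Variables (a1 a2 a3 p q s th : 'rV[F]_N) (x y w b1 b2 b3 r : F).

Fact absorb1 :
  - (wedge p a1 + x *: wedge a2 a3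
     + (wedge (q + (b1 *: a1 + b2 *: a2 + b3 *: a3 + th)) a2
        + y *: (- wedge a1 a3))
     + (wedge s a3 + w *: (r *: wedge a1 a2))) =
  wedge (- p + (0 *: a1 + (b1 + r * w) *: a2 + - y *: a3)) a1
  + wedge (- q + (0 *: a1 + 0 *: a2 + 0 *: a3)) a2
  + wedge (- s + (0 *: a1 + (b3 - x) *: a2 + 0 *: a3)) a3
  - wedge th a2.
Proof. by apply/matrixP => k l; rewrite !mxE; ring_atoms. Qed.

Fact absorb2 :
  - (wedge p a1 + x *: wedge a2 a3
     + (wedge q a2 + y *: (- wedge a1 a3))
     + (wedge (s + (b1 *: a1 + b2 *: a2 + b3 *: a3 + th)) a3
        + w *: (r *: wedge a1 a2))) =
  wedge (- p + (0 *: a1 + 0 *: a2 + 0 *: a3)) a1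
  + wedge (- q + (- (r * w) *: a1 + 0 *: a2 + (b2 + x) *: a3)) a2
  + wedge (- s + ((y - b1) *: a1 + 0 *: a2 + 0 *: a3)) a3
  - wedge th a3.
Proof. by apply/matrixP => k l; rewrite !mxE; ring_atoms. Qed.

Fact absorb3 (u v : F) :
  - (wedge (p + (b1 *: a1 + b2 *: a2 + b3 *: a3 + th)) a1 + x *: wedge a2 a3
     + (wedge q a2 + y *: (- wedge a1 a3))
     + (wedge s a3 + w *: (r *: wedge a1 a2))) =
  wedge (- p + (0 *: a1 + u *: a2 + 0 *: a3)) a1
  + wedge (- q + (v *: a1 + 0 *: a2 + 0 *: a3)) a2
  + wedge (- s + ((b3 + y) *: a1 + - x *: a2 + 0 *: a3)) a3
  + (b2 - r * w + u - v) *: wedge a1 a2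
  - wedge th a1.
Proof. by apply/matrixP => k l; rewrite !mxE; ring_atoms. Qed.

End Absorption.

End Pairing.

Section Torsion.
Variables (F : realType) (Sigma : manifold F 3) (R I J K : Sigma -> F).
Variable alpha : 'I_3 -> local1 (matlas Sigma).
Hypotheses (sI : smooth_fun (matlas Sigma) I)
  (sJ : smooth_fun (matlas Sigma) J) (sK : smooth_fun (matlas Sigma) K).
Hypothesis cartan_alpha : cartan_structure R alpha.

Local Notation AT := (atlasT Sigma).
Local Notation ET := (SigmaT Sigma).
Local Notation alphaT := (alphaT alpha).
Local Notation theta := (theta R I J K alpha).
Local Notation ajet := (ajet R I J K).
Local Notation structure_eqs := (structure_eqs R I J K alpha).
Local Notation cong_theta := (cong_theta R I J K alpha).
Local Notation torsion := (torsion R I J K alpha).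
Local Notation dB12 := (B12_dot R I J K alpha).
Local Notation dB23 := (B23_dot R I J K alpha).
Local Notation jet_frame := (jet_frame R I J K alpha).
Local Notation dB31 := (B31_dot R I J K alpha).
Implicit Types (c : chart_index AT) (z : ET).

Let sR : smooth_fun (matlas Sigma) R.
Proof. by case: cartan_alpha. Qed.

Let coframe_alpha : coframing alpha.
Proof. by case: cartan_alpha. Qed.

(** On the jet frame, the form Pi with labels j and k distinct contributes
    opposite terms to the pairings of d theta_ij and d theta_ik, and that with
    labels j and j contributes nothing. *)
Lemma structure_eqs_torsion i c z P t : chart_dom c z ->
  structure_eqs i c z P t ->
  t = pairing (dform (theta i i1) c z) (jet_frame c z i2) (jet_frame c z i3)
    + pairing (dform (theta i i2) c z) (jet_frame c z i3) (jet_frame c z i1)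
    + pairing (dform (theta i i3) c z) (jet_frame c z i1) (jet_frame c z i2).
Proof.
move=> cz [E1 E2 E3].
have tE X Y k l : cong_theta c z X Y ->
    pairing X (jet_frame c z k) (jet_frame c z l) =
    pairing Y (jet_frame c z k) (jet_frame c z l).
  move=> [beta ->]; rewrite pairingD pairing_sum big1 ?addr0// => i' _.
  rewrite pairing_sum big1// => j' _.
  have th0 m : (theta i' j' c z *m jet_frame c z m) 0 0 = 0.
    by rewrite theta_jet_frame// mxE.
  by rewrite pairing_wedge !th0 mulr0 mul0r subrr.
have al j k : (alphaT j c z *m jet_frame c z k) 0 0 = (j == k)%:R.
  by rewrite alphaT_jet_frame// mxE eqxx mulr1n.
move: (jet_frame c z) al tE => e al tE.
have E := congr2 +%R (congr2 +%R (tE _ _ i2 i3 E1) (tE _ _ i3 i1 E2))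
  (tE _ _ i1 i2 E3).
apply: etrans (esym E) => {tE E1 E2 E3 E}.
move: (alphaT^~ c^~ z) al => a al.
rewrite !pairingD pairingZ !pairing_wedge !al !eqE /=.
by ring_atoms.
Qed.

Lemma dform_alphaT c z : chart_dom c z ->
  [/\ dform (alphaT i1) c z = wedge (alphaT i2 c z) (alphaT i3 c z),
      dform (alphaT i2) c z = - wedge (alphaT i1 c z) (alphaT i3 c z) &
      dform (alphaT i3) c z = R z.1 *: wedge (alphaT i1 c z) (alphaT i2 c z)].
Proof.
move=> cz; have [_ [oa _] /(_ c z.1 cz)[S1 S2 S3]] := cartan_alpha.
rewrite !wedge_row_mx0 !dform_pull_fst// S1 S2 S3.
by split => //; rewrite ?opp_block_mx ?scale_block_mx ?oppr0 ?scaler0.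
Qed.

Lemma dform_theta i j c z : chart_dom c z -> dform (theta i j) c z =
  - \sum_k (wedge (dfun (ajet i j k) c z) (alphaT k c z)
            + ajet i j k z *: dform (alphaT k) c z).
Proof.
move=> cz; have oa k := one_form_alphaT coframe_alpha k.
have sa k := smooth_ajet sR sI sJ sK i j k.
have oja k : one_form ((fun c w => ajet i j k w *: alphaT k c w) : local1 AT).
  exact: one_formZ.
have od := one_form_dfun (@smooth_acoord F Sigma i j).
rewrite (_ : theta i j = fun c w => dfun (A := AT) (fun w => acoord w i j) c w +
    (- \sum_k ajet i j k w *: alphaT k c w))//.
rewrite dformD//; last by apply: one_formN; exact: one_form_sum.
rewrite dform_dfun//; last exact: smooth_acoord.
rewrite add0r (_ : (fun c w => - _) = fun c w =>
    \sum_k (fun w => - ajet i j k w) w *: alphaT k c w).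
  have sNa k : smooth_fun AT (fun w => - ajet i j k w) by exact: smooth_funN.
  rewrite dform_sum//; last by move=> k; exact: one_formZ.
  rewrite -sumrN; apply: eq_bigr => k _; rewrite dformZ//.
  have -> : dfun (fun w => - ajet i j k w) c z = - dfun (ajet i j k) c z.
    have := dfunM (smooth_fun_cst (A := AT) (-1)) (sa k) cz.
    rewrite dfun_cst scaler0 add0r scaleN1r => <-.
    by congr (dfun _ c z); apply/funext => w; rewrite mulN1r.
  by rewrite scaleNr wedgeNl opprD.
apply/funext => c'; apply/funext => w; rewrite -sumrN.
by apply: eq_bigr => k _; rewrite scaleNr.
Qed.

Lemma cong_theta_wedge c z X Y (h : 'M[F]_3) v :
  X = Y - wedge (\sum_i \sum_j h i j *: theta i j c z) v -> cong_theta c z X Y.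
Proof.
move=> ->; exists (fun i j => h i j *: v); congr (_ + _).
rewrite wedge_suml -sumrN; apply: eq_bigr => i _.
rewrite wedge_suml -sumrN; apply: eq_bigr => j _.
by rewrite !wedgeZl -scalerN -wedgeC.
Qed.

(** The coefficients of the alpha^k in Pi_im. For each i the structure equations
    without torsion are nine linear equations in them, one for each theta_ij and
    each alpha^k /\ alpha^l. The eight values below solve one equation each; the
    ninth one, for alpha^1 /\ alpha^2 in d theta_i3, only holds up to T_i3. *)
Definition absorber (i : 'I_3) (m : 'I_6) (k : 'I_3) z : F :=
  match val m, val k with
  | 0, 1 => dB12 i i1 z + R z.1 * ajet i i1 i3 z
  | 0, 2 => - ajet i i1 i2 z
  | 2, 1 => dB12 i i3 z - ajet i i1 i1 z
  | 3, 0 => - (R z.1 * ajet i i2 i3 z)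
  | 3, 2 => dB23 i i2 z + ajet i i2 i1 z
  | 4, 0 => ajet i i2 i2 z - dB23 i i1 z
  | 5, 0 => dB31 i i3 z + ajet i i3 i2 z
  | 5, 1 => - ajet i i3 i1 z
  | _, _ => 0
  end.

Definition Pi_form (i : 'I_3) (m : 'I_6) : local1 AT := fun c z =>
  - dfun (fun w => qcoord w i m) c z
  + \sum_k absorber i m k z *: alphaT k c z.

Lemma smooth_absorber i m k : smooth_fun AT (absorber i m k).
Proof.
have sa a b d : smooth_fun AT (ajet a b d) by exact: smooth_ajet.
have sRT := smooth_base sR.
have [_ s12 _] := total_deriv_B12T sR sI sJ sK coframe_alpha i.
have [_ s23 _] := total_deriv_B23T sR sI sJ sK coframe_alpha i.
have [_ s31 _] := total_deriv_B31T sR sI sJ sK coframe_alpha i.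
have s0 : smooth_fun AT (fun=> 0) by exact: smooth_fun_cst.
case: m => [[|[|[|[|[|[|//]]]]]] hm]; case: k => [[|[|[|//]]] hk];
  rewrite /absorber /=; try exact: s0.
- apply: smooth_funD; first exact: s12.
  by apply: smooth_funM; [exact: sRT|exact: sa].
- by apply: smooth_funN; exact: sa.
- by apply: smooth_funD; [exact: s12|apply: smooth_funN; exact: sa].
- by apply: smooth_funN; apply: smooth_funM; [exact: sRT|exact: sa].
- by apply: smooth_funD; [exact: s23|exact: sa].
- by apply: smooth_funD; [exact: sa|apply: smooth_funN; exact: s23].
- by apply: smooth_funD; [exact: s31|exact: sa].
- by apply: smooth_funN; exact: sa.
Qed.

Lemma one_form_Pi i m : one_form (Pi_form i m).
Proof.
apply: one_formD.
  by apply: one_formN; apply: one_form_dfun; exact: smooth_qcoord.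
apply: one_form_sum => k; apply: one_formZ; first exact: smooth_absorber.
exact: one_form_alphaT.
Qed.

Lemma structure_eqs_Pi i c z : chart_dom c z ->
  structure_eqs i c z (fun m => Pi_form i m c z) (torsion i z).
Proof.
move=> cz; have [D1 D2 D3] := dform_alphaT cz.
have tB12 := total_deriv_B12T sR sI sJ sK coframe_alpha i.
have tB23 := total_deriv_B23T sR sI sJ sK coframe_alpha i.
have tB31 := total_deriv_B31T sR sI sJ sK coframe_alpha i.
(* The differentials of the a_ij.k that (S) expresses by the others. *)
have dB m B Bdot : total_deriv R I J K alpha B Bdot -> exists h : 'M[F]_3,
    dfun (fun w => qcoord w i m + B w) c z = dfun (fun w => qcoord w i m) c z
    + (Bdot i1 z *: alphaT i1 c z + Bdot i2 z *: alphaT i2 c z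
       + Bdot i3 z *: alphaT i3 c z
       + \sum_i \sum_j h i j *: theta i j c z).
  move=> [sB _ /(_ c z cz)[h Eh]]; exists h.
  by rewrite (dfunD (@smooth_qcoord F Sigma i m) sB cz) Eh sum3.
have [h12 E12] := dB s21 _ _ tB12.
have [h23 E23] := dB s32 _ _ tB23.
have [h31 E31] := dB s13 _ _ tB31.
split.
- apply: (@cong_theta_wedge c z _ _ h12 (alphaT i2 c z)).
  rewrite (dform_theta i i1 cz) sum3 D1 D2 D3.
  rewrite (_ : ajet i i1 i2 = fun w => qcoord w i s21 + B12T R I J K i w)//.
  rewrite E12 /Pi_form !sum3; exact: absorb1.
- apply: (@cong_theta_wedge c z _ _ h23 (alphaT i3 c z)).
  rewrite (dform_theta i i2 cz) sum3 D1 D2 D3.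
  rewrite (_ : ajet i i2 i3 = fun w => qcoord w i s32 + B23T I J K i w)//.
  rewrite E23 /Pi_form !sum3; exact: absorb2.
- apply: (@cong_theta_wedge c z _ _ h31 (alphaT i1 c z)).
  rewrite (dform_theta i i3 cz) sum3 D1 D2 D3.
  rewrite (_ : ajet i i3 i1 = fun w => qcoord w i s13 + B31T I J K i w)//.
  rewrite E31 /Pi_form !sum3.
  have -> : torsion i z = dB31 i i2 z - R z.1 * ajet i i3 i3 z
      + absorber i s13 i2 z - absorber i s32 i1 z.
    rewrite torsionE /absorber /= /B12_dot /B23_dot /B31_dot.
    have -> : fder alpha R i3 z = 0.
      by have [_ _ S] := cartan_alpha; exact: (bianchi sR coframe_alpha S).
    by move: (finsler_coef_dot R I J K alpha i) (ajet i) => N a'; ring.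
  exact: absorb3.
Qed.

(** By [structure_eqs_torsion], any two choices of the Pi's that satisfy the
    structure equations have the same torsion. *)
Lemma absorbable_Pi i z :
  absorbable R I J K alpha Pi_form i z <-> torsion i z = 0.
Proof.
split=> [[s Hs]|T0].
  have [c cz] := chart_cover AT z.
  rewrite (structure_eqs_torsion cz (structure_eqs_Pi i cz)).
  by rewrite -(structure_eqs_torsion cz (Hs c cz)).
exists 0 => c cz.
have -> : (fun m => Pi_form i m c z
    + \sum_k (0 : 'M[F]_(6, 3)) m k *: alphaT k c z) =
    (fun m => Pi_form i m c z).
  apply/funext => m; rewrite big1 ?addr0// => k _.
  by rewrite mxE scale0r.
by rewrite -T0; exact: structure_eqs_Pi.
Qed.

Lemma mxvec_index_eq m n (i i' : 'I_m) (j j' : 'I_n) :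
  (mxvec_index i j == mxvec_index i' j') = ((i == i') && (j == j')).
Proof.
have := congr1 (fun v : 'rV[F]_(m * n) => v 0 (mxvec_index i j))
  (mxvec_delta F i' j').
rewrite mxvecE !mxE eqxx /=; case: (mxvec_index i j == _) => /=;
  case: (_ && _) => //= /eqP; rewrite ?oner_eq0// eq_sym ?oner_eq0//.
Qed.

(** The components along the free coordinates a_ij.k vanish for the theta_ij and
    the alpha^k, and are those of - dq_im for Pi_im. *)
Lemma indep_mod_Pi : indep_mod R I J K alpha Pi_form.
Proof.
move=> c z cz x y w E; apply/matrixP => i m; rewrite [RHS]mxE.
have a0 k : alphaT k c z 0 (rshift 3 (qidx i m)) = 0.
  by rewrite /Defs.alphaT /pull_fst row_mxEr mxE.
have suma0 (v : 'I_3 -> F) :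
    (\sum_k v k *: alphaT k c z) 0 (rshift 3 (qidx i m)) = 0.
  by rewrite summxE big1// => k _; rewrite mxE a0 mulr0.
have th0 i' j' : theta i' j' c z 0 (rshift 3 (qidx i m)) = 0.
  rewrite /Defs.theta mxE dfun_acoord [X in _ + X]mxE suma0 subr0 mxE eqxx /=.
  by rewrite /aidx /qidx eq_rshift eq_rlshift.
have Pi0 i' m' : Pi_form i' m' c z 0 (rshift 3 (qidx i m)) =
    - ((i' == i) && (m' == m))%:R.
  rewrite /Pi_form mxE suma0 addr0 dfun_qcoord !mxE eqxx /=.
  by rewrite /qidx !eq_rshift mxvec_index_eq eq_sym [m == _]eq_sym.
have := congr1 (fun v : 'rV[F]_(3 + (3 * 3 + 3 * 6)) =>
  v 0 (rshift 3 (qidx i m))) E.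
rewrite [RHS]mxE suma0 addr0 summxE [RHS]summxE.
rewrite [RHS]big1 => [|i' _]; last first.
  by rewrite summxE big1// => j' _; rewrite mxE th0 mulr0.
rewrite (bigD1 i)//= summxE (bigD1 m)//= mxE Pi0 !eqxx.
rewrite big1 => [|m' mm]; last by rewrite mxE Pi0 (negbTE mm) andbF oppr0 mulr0.
rewrite big1 => [|i' ii]; last first.
  rewrite summxE big1// => m' _.
  by rewrite mxE Pi0 (negbTE ii) oppr0 mulr0.
by rewrite !addr0 mulrN1 => /eqP; rewrite oppr_eq0 => /eqP.
Qed.

End Torsion.

Theorem theorem2p1 (F : realType) (Sigma : manifold F 3)
  (R I J K : Sigma -> F)
  (alpha omega : 'I_3 -> local1 (matlas Sigma))
  (A : 'I_3 -> 'I_3 -> Sigma -> F)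
  (Halpha : cartan_structure R alpha)
  (Homega : finsler_structure I J K omega)
  (HA_smooth : forall i j, smooth_fun (matlas Sigma) (A i j))
  (HA : forall i c p, chart_dom c p ->
     omega i c p = \sum_j A i j p *: alpha j c p)
  (HS : forall p, system_S (R p) (I p) (J p) (K p) (\matrix_(i, j) A i j p)
     (fun i j k => frame_deriv alpha (A i j) p 0 k)) :
  exists Pi : 'I_3 -> 'I_6 -> local1 (atlasT Sigma),
    [/\ (forall i m, one_form (Pi i m)),
        indep_mod R I J K alpha Pi,
        (forall i c z, chart_dom c z ->
           structure_eqs R I J K alpha i c z (fun m => Pi i m c z)
             (torsion R I J K alpha i z)) &
        (forall i z, absorbable R I J K alpha Pi i z <->
           torsion R I J K alpha i z = 0)].
Proof.
have [[sI sJ sK] _ _] := Homega.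
exists (Pi_form R I J K alpha); split.
- by move=> i m; exact: one_form_Pi.
- exact: indep_mod_Pi.
- by move=> i c z; exact: structure_eqs_Pi.
- by move=> i z; exact: absorbable_Pi.
Qed.
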